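(* Let $N_0$ be a positive integer and let $\{M_N\}_{N\geq N_0}$ be positive integers with $\lim_{N\to\infty}M_N=\infty$. For each $N\geq N_0$, let $\mathbf{r}^{(N)}\in\mathbb{R}^{M_N}$ and $\mathbf{c}^{(N)}\in\mathbb{R}^N$ be positive vectors with $\Vert\mathbf{r}^{(N)}\Vert_1=\Vert\mathbf{c}^{(N)}\Vert_1=:s^{(N)}$, let $\widetilde{A}^{(N)}\in\mathbb{R}^{M_N\times N}$ be a positive random matrix, and let $A^{(N)}=\mathbb{E}[\widetilde{A}^{(N)}]$. Let $\widetilde{P}^{(N)}$ and $P^{(N)}$ be the (uniquely determined) matrices obtained from $\widetilde{A}^{(N)}$ and $A^{(N)}$, respectively, by scaling them to row sums $\mathbf{r}^{(N)}$ and column sums $\mathbf{c}^{(N)}$. Suppose that for each index $N$ the entries of $\widetilde{A}^{(N)}$ are independent, and that $\widetilde{A}^{(N)}_{i,j}\in[a,b]$ almost surely for all $i\in[M_N]$, $j\in[N]$, and some universal positive constants $a,b$ (independent of $N$). Then $$\Vert\widetilde{P}^{(N)}-P^{(N)}\Vert_2=\mathcal{O}_{\text{w.h.p}}\left(\rho_1^{(N)}\rho_2^{(N)}\rho_3^{(N)}\sqrt{\log(\max\{M_N,N\})}\right).$$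
   Context: $[n]=\{1,\ldots,n\}$. A matrix or vector is positive if all its entries are strictly positive. A pair of vectors $(\mathbf{x},\mathbf{y})$ scales a matrix $B\in\mathbb{R}^{M\times N}$ to row sums $\mathbf{r}$ and column sums $\mathbf{c}$ if $\sum_{j=1}^N x_iB_{i,j}y_j=r_i$ for all $i\in[M]$ and $\sum_{i=1}^M x_iB_{i,j}y_j=c_j$ for all $j\in[N]$. For positive $B,\mathbf{r},\mathbf{c}$ with $\Vert\mathbf{r}\Vert_1=\Vert\mathbf{c}\Vert_1$, a positive scaling pair exists, is unique up to replacing $(\mathbf{x},\mathbf{y})$ by $(\alpha\mathbf{x},\alpha^{-1}\mathbf{y})$ with $\alpha>0$, and the scaled matrix $D(\mathbf{x})BD(\mathbf{y})$ is therefore unique, where $D(\mathbf{v})$ is the diagonal matrix with $\mathbf{v}$ on its main diagonal. Thus $\widetilde{P}^{(N)}=D(\widetilde{\mathbf{x}}^{(N)})\widetilde{A}^{(N)}D(\widetilde{\mathbf{y}}^{(N)})$ and $P^{(N)}=D(\mathbf{x}^{(N)})A^{(N)}D(\mathbf{y}^{(N)})$ for any positive pairs scaling $\widetilde{A}^{(N)}$, respectively $A^{(N)}$, to row sums $\mathbf{r}^{(N)}$ and column sums $\mathbf{c}^{(N)}$. The following quantities are used: $$\rho_1^{(N)}=\max\left\{\frac{\Vert\mathbf{r}^{(N)}\Vert_2}{s^{(N)}},\frac{\Vert\mathbf{c}^{(N)}\Vert_2}{s^{(N)}}\right\},\qquad\rho_2^{(N)}=\max\left\{\frac{s^{(N)}}{M_N\min_i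 r_i^{(N)}},\frac{s^{(N)}}{N\min_j c_j^{(N)}}\right\},$$ $$\rho_3^{(N)}=\frac{\sqrt{M_N}\max_i r_i^{(N)}\cdot\sqrt{N}\max_j c_j^{(N)}}{s^{(N)}}.$$ For matrices, $\Vert\cdot\Vert_2$ is the operator (spectral) norm; for vectors, it is the Euclidean norm. For a sequence of random variables $X_N$ and a deterministic sequence $\gamma_N$, $X_N=\mathcal{O}_{\text{w.h.p}}(\gamma_N)$ means that there exists a constant $C$ (independent of $N$) with $\lim_{N\to\infty}\Pr\{X_N\leq C\gamma_N\}=1$. *)

(* Defs.v *)
From HB Require Import structures.
From mathcomp Require Export all_boot all_order all_algebra.
From mathcomp Require Export all_classical all_reals all_analysis.

Set Implicit Arguments.
Unset Strict Implicit.
Unset Printing Implicit Defensive.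

Import Order.TTheory GRing.Theory Num.Theory.
Import numFieldNormedType.Exports.

Local Open Scope classical_set_scope.
Local Open Scope ring_scope.

Section Norms.
Context {R : realType}.

Definition l1norm n (v : 'cV[R]_n) : R := \sum_i `|v i 0|.

(* The library's `|v| on matrices is the entrywise maximum, hence l2norm and
   op_norm. *)
Definition l2norm n (v : 'cV[R]_n) : R := Num.sqrt (\sum_i v i 0 ^+ 2).

Definition op_norm m n (B : 'M[R]_(m, n)) : R :=
  sup [set l2norm (B *m v) | v in [set v : 'cV[R]_n | l2norm v <= 1]].

(* For n > 0 these range over a finite nonempty set, so they are the maximum
   and the minimum of the entries. *)
Definition max_entry n (v : 'cV[R]_n) : R := sup (range (fun i => v i 0)).
Definition min_entry n (v : 'cV[R]_n) : R := inf (range (fun i => v i 0)).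

End Norms.

Section Scaling.
Context {R : realType}.

Definition positive_mx m n (B : 'M[R]_(m, n)) : Prop := forall i j, 0 < B i j.

Definition scales m n (x : 'cV[R]_m) (y : 'cV[R]_n) (B : 'M[R]_(m, n))
    (r : 'cV[R]_m) (c : 'cV[R]_n) : Prop :=
  (forall i, \sum_j x i 0 * B i j * y j 0 = r i 0) /\
  (forall j, \sum_i x i 0 * B i j * y j 0 = c j 0).

(* Pmx is obtained from B by scaling it to row sums r and column sums c; for
   positive B, r, c with l1norm r = l1norm c there is exactly one such Pmx. *)
Definition scaled_to m n (B : 'M[R]_(m, n)) (r : 'cV[R]_m) (c : 'cV[R]_n)
    (Pmx : 'M[R]_(m, n)) : Prop :=
  exists (x : 'cV[R]_m) (y : 'cV[R]_n),
    [/\ positive_mx x, positive_mx y, scales x y B r c &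
        Pmx = diag_mx x^T *m B *m diag_mx y^T].

(* In rho1, rho2, rho3 the common sum s is read off as l1norm r. *)
Definition rho1 m n (r : 'cV[R]_m) (c : 'cV[R]_n) : R :=
  Num.max (l2norm r / l1norm r) (l2norm c / l1norm r).

Definition rho2 m n (r : 'cV[R]_m) (c : 'cV[R]_n) : R :=
  Num.max (l1norm r / (m%:R * min_entry r)) (l1norm r / (n%:R * min_entry c)).

Definition rho3 m n (r : 'cV[R]_m) (c : 'cV[R]_n) : R :=
  (Num.sqrt m%:R * max_entry r) * (Num.sqrt n%:R * max_entry c) / l1norm r.

End Scaling.

Section Probability.
Context {R : realType}.

(* Mutual independence: the product rule over every subfamily J. *)
Definition mutually_independent d (T : measurableType d)
    (P : probability T R) (I : finType) (X : I -> {RV P >-> R}) : Prop :=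
  forall (J : {set I}) (B : I -> set R), (forall i, measurable (B i)) ->
    P [set w | forall i, i \in J -> B i (X i w)]
    = (\prod_(i in J) P (X i @^-1` B i))%E.

(* The N-th variable may live on its own probability space. P N is an
   unconstrained set function off the measurable sets, so a proof of the limit
   has to show the events measurable. *)
Definition bigO_whp (d : nat -> measure_display)
    (T : forall N, measurableType (d N)) (P : forall N, probability (T N) R)
    (X : forall N, T N -> R) (g : nat -> R) : Prop :=
  exists C : R,
    P N [set w | X N w <= C * g N] @[N --> \oo] --> 1%E.

End Probability.

(* Main.v *)
(* The scaling problem is stable in a deterministic, entrywise sense: if (x, y)
   scales A exactly and x, y scale B up to relative errors e in every row and
   column sum, then x'_i y'_j = x_i y_j (1 + O(e)) for any pair (x', y') scaling B
   exactly.  Indeed x' / x and y' / y are, up to factors 1 + O(e), inverse to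
   weighted averages of each other, and as the entries lie in [a, b] these
   averages contract oscillation ratios by 1 - a / b.

   Hoeffding's inequality makes e = O(rho1 sqrt (log q)), q = max(M, N), with high
   probability, which bounds D(x') B D(y') - D(x) B D(y) entrywise.  The remaining
   term D(x) (B - A) D(y) is controlled by the norm of B - A; the factor
   sqrt (log q) leaves room for a union bound over all pairs of grid vectors with
   coordinates in (1/q) Z, of which there are only q^O(q), and rounding a unit
   vector to the grid costs O(sqrt q) by the trivial entrywise bound.  Of rho2 only
   rho2 >= 1 is used.

   The same stability estimate shows that the scaled matrix depends continuously
   on the entries, hence that the events are measurable. *)

Require Import Defs.
From mathcomp Require Import measurable_realfun ring lra zify.

Set Implicit Arguments.
Unset Strict Implicit.
Unset Printing Implicit Defensive.

Import Order.TTheory GRing.Theory Num.Theory.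
Import numFieldNormedType.Exports.

Local Open Scope classical_set_scope.
Local Open Scope ring_scope.

(** * Expectation of a product of independent variables *)

Section IndependentProduct.
Local Open Scope ereal_scope.
Context d (T : measurableType d) (R : realType).
Import HBNNSimple.

(** The hypothesis is the case of indicators [f]: [g] averages to [k] on every event determined by
    [X]. Linearity extends this to simple functions, and monotone convergence to nonnegative [f]. *)
Lemma ge0_integral_factor (mu : {measure set T -> \bar R})
    (g : T -> R) (X : {mfun T >-> R}) (f : R -> R) (k : R) :
  measurable_fun [set: T] g -> (forall w, (0 <= g w)%R) ->
  measurable_fun [set: R] f -> (forall t, (0 <= f t)%R) -> (0 <= k)%R ->
  (forall B, measurable B ->
     \int[mu]_(w in X @^-1` B) (g w)%:E = k%:E * mu (X @^-1` B)) ->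
  \int[mu]_w (g w * f (X w))%:E = k%:E * \int[mu]_w (f (X w))%:E.
Proof.
move=> mg g0 mf f0 k0 H.
have mfE : measurable_fun [set: R] (EFin \o f) by exact/measurable_EFinP.
pose h := nnsfun_approx measurableT mfE.
have mhX n : measurable_fun [set: T] (h n \o X) by exact: measurableT_comp.
have mind n r : measurable_fun [set: T] (\1_(h n @^-1` [set r]) \o X : T -> R).
  exact: measurableT_comp.
have mpre n r : measurable (h n @^-1` [set r]) by exact: measurable_funPTI.
have mpreX B : measurable B -> measurable (X @^-1` B).
  by move=> mB; exact: measurable_funPTI.
have -> : \int[mu]_w (f (X w))%:E =
    lim (\int[mu]_w (h n (X w))%:E @[n --> \oo]).
  have fE w : (f (X w))%:E = lim ((EFin \o h n) (X w) @[n --> \oo]).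
    by apply/esym/cvg_lim => //; apply: cvg_nnsfun_approx => // x _; rewrite lee_fin.
  under eq_integral => x _ do rewrite fE.
  apply: monotone_convergence => //.
  - by move=> n; apply/measurable_EFinP; exact: mhX.
  - by move=> n x _ /=; rewrite lee_fin.
  - by move=> x _ a b ab; rewrite lee_fin; exact/lefP/nd_nnsfun_approx.
rewrite -limeMl //; last first.
  apply: ereal_nondecreasing_is_cvgn => m n mn; apply: ge0_le_integral => //.
  - by move=> x _; rewrite lee_fin.
  - by apply/measurable_EFinP; exact: mhX.
  - by apply/measurable_EFinP; exact: mhX.
  - by move=> x _; rewrite lee_fin; exact/lefP/nd_nnsfun_approx.
have -> : \int[mu]_w (g w * f (X w))%:E =
    lim (\int[mu]_w (g w * h n (X w))%:E @[n --> \oo]).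
  have fE w : (g w * f (X w))%:E = lim ((g w * h n (X w))%:E @[n --> \oo]).
    apply/esym/cvg_lim => //; rewrite EFinM.
    under eq_fun do rewrite EFinM.
    apply: cvgeZl => //.
    by apply: cvg_nnsfun_approx => // x _; rewrite lee_fin.
  under eq_integral => x _ do rewrite fE.
  apply: monotone_convergence => //.
  - by move=> n; apply/measurable_EFinP; apply: measurable_funM => //; exact: mhX.
  - by move=> n x _ /=; rewrite lee_fin mulr_ge0.
  - move=> x _ a b ab; rewrite lee_fin ler_wpM2l//.
    exact/lefP/nd_nnsfun_approx.
suff suf n : \int[mu]_w (g w * h n (X w))%:E = k%:E * \int[mu]_w (h n (X w))%:E.
  by under eq_fun do rewrite suf.
have hE w : h n (X w) =
    (\sum_(y \in range (h n)) y * \1_(h n @^-1` [set y]) (X w))%R.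
  by rewrite {1}fimfunE.
have nneg y w : (0 <= y * \1_(h n @^-1` [set y]) (X w))%R.
  rewrite indicE; case: (boolP (_ \in _)) => [|_]; last by rewrite mulr0.
  by rewrite inE /= => <-; rewrite mulr1.
have my y : measurable_fun [set: T] (fun w => (y * \1_(h n @^-1` [set y]) (X w))%:E).
  by apply/measurable_EFinP; apply: measurable_funM => //; exact: mind.
under eq_integral => w _.
  by rewrite hE EFinM -fsumEFin// ge0_mule_fsumr; [over | move=> y; rewrite lee_fin].
under [in RHS]eq_integral => w _ do rewrite hE -fsumEFin//.
rewrite !ge0_integral_fsum//; first last.
- by move=> y w _; rewrite mule_ge0 ?lee_fin.
- by move=> y; apply: emeasurable_funM => //; exact/measurable_EFinP.
- by move=> y w _; rewrite lee_fin.
rewrite ge0_mule_fsumr; last first.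
  by move=> y; apply: integral_ge0 => w _; rewrite lee_fin.
apply: eq_fsbigr => y; rewrite inE => -[t _ yE].
have y0 : (0 <= y)%R by rewrite -yE.
have indE w : \1_(h n @^-1` [set y]) (X w) =
  \1_(X @^-1` (h n @^-1` [set y])) w :> R by rewrite !indicE.
have pE w : (g w)%:E * (\1_(X @^-1` (h n @^-1` [set y])) w)%:E =
    ((EFin \o g) \_ (X @^-1` (h n @^-1` [set y]))) w by rewrite epatch_indic.
under eq_integral => w _.
  rewrite EFinM muleCA indE pE; over.
under [in RHS]eq_integral => w _ do rewrite EFinM indE.
have mgE : measurable_fun [set: T] (fun w => (g w)%:E) by exact/measurable_EFinP.
have mind' : measurable_fun [set: T]
    (fun w => (\1_(X @^-1` (h n @^-1` [set y])) w)%:E : \bar R).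
  by apply/measurable_EFinP; exact: measurable_indic (mpreX _ (mpre _ _)).
rewrite !ge0_integralZl//; last first.
- by move=> w _; rewrite epatch_indic mule_ge0 ?lee_fin.
- by rewrite epatch_indic; apply: emeasurable_funM.
rewrite -integral_mkcond H// integral_indic ?setIT//; last exact: mpreX.
by rewrite muleCA.
Qed.

End IndependentProduct.

(** The product rule for events passes to functions by integrating out one factor at a time. *)
Lemma expectation_prod_indep d (T : measurableType d) (R : realType)
    (P : probability T R) (I : finType) (X : I -> {RV P >-> R})
    (f : I -> R -> R) (e : I -> R) :
  mutually_independent X ->
  (forall i, measurable_fun [set: R] (f i)) -> (forall i t, 0 <= f i t) ->
  (forall i, (\int[P]_w (f i (X i w))%:E)%E = (e i)%:E) ->
  (\int[P]_w (\prod_i f i (X i w))%:E)%E = (\prod_i e i)%:E.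
Proof.
move=> indep mf f0 fe.
have e0 i : 0 <= e i.
  by rewrite -lee_fin -fe; apply: integral_ge0 => w _; rewrite lee_fin.
have mfX i : measurable_fun [set: T] (fun w => f i (X i w)).
  by apply: measurableT_comp; [exact: mf | exact: measurable_funPT].
pose D (J : {set I}) (B : I -> set R) := [set w | forall i, i \in J -> B i (X i w)].
have mD J B : (forall i, measurable (B i)) -> measurable (D J B).
  move=> mB; have -> : D J B = \bigcap_(i in [set` J]) (X i @^-1` B i).
    by apply/seteqP; split => w /= h i; exact: h.
  apply: fin_bigcap_measurable; first exact: finite_finset.
  by move=> i _; exact: measurable_funPTI.
(* The event [D J B] on indices outside [s] strengthens the induction: splitting off the head factor
   [f k] asks for the same identity on events that also constrain [X k]. *)
have gen (s : seq I) : uniq s -> forall (J : {set I}) (B : I -> set R),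
    (forall i, measurable (B i)) -> (forall i, i \in s -> i \notin J) ->
    (\int[P]_(w in D J B) (\prod_(i <- s) f i (X i w))%:E
     = (\prod_(i <- s) e i)%:E * P (D J B))%E.
  elim: s => [_ J B mB _|k s IH /= /andP[ks us] J B mB sJ].
    under eq_integral => w _ do rewrite big_nil.
    by rewrite big_nil integral_cst//; exact: mD.
  have PDfin : P (D J B) \is a fin_num by exact: fin_num_measure (mD _ _ mB).
  have mg : measurable_fun [set: T] (fun w => \prod_(i <- s) f i (X i w)).
    by apply: measurable_prod => i _; exact: mfX.
  transitivity (\int[P]_w (\1_(D J B) w * (\prod_(i <- s) f i (X i w)) * f k (X k w))%:E)%E.
    rewrite integral_mkcond; apply: eq_integral => w _.
    by rewrite epatch_indic /= -EFinM big_cons; congr EFin; ring.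
  rewrite (@ge0_integral_factor _ _ _ _ _ (X k) (f k)
    ((\prod_(i <- s) e i) * fine (P (D J B)))) //.
  - by rewrite fe big_cons !EFinM fineK// muleAC [X in (X * _ = _)%E]muleC.
  - by apply: measurable_funM => //; exact: measurable_indic (mD _ _ mB).
  - by move=> w; rewrite mulr_ge0// prodr_ge0.
  - by rewrite mulr_ge0 ?prodr_ge0// fine_ge0.
  move=> C mC.
  (* The condition that [X k] lies in [C] joins the event as index [k], so the induction hypothesis
     applies to [k |: J]; independence then splits its probability off again. *)
  pose B' i := if i == k then C else B i.
  have mB' i : measurable (B' i) by rewrite /B'; case: ifP.
  have kJ : k \notin J by rewrite sJ// mem_head.
  have DE : D (k |: J)%SET B' = X k @^-1` C `&` D J B.
    apply/seteqP; split => w /=.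
      move=> h; split; first by have := h k (setU11 _ _); rewrite /B' eqxx.
      move=> i iJ; have := h i (setU1r _ iJ); rewrite /B'.
      by case: eqP => // ik; rewrite -ik iJ in kJ.
    move=> [hC hD] i; rewrite in_setU1 /B'.
    by case: eqP => [-> _|_ /=]; [exact: hC | exact: hD].
  have PE : P (D (k |: J)%SET B') = (P (X k @^-1` C) * P (D J B))%E.
    rewrite !indep// big_setU1//= {1}/B' eqxx; congr (_ * _)%E.
    by apply: eq_bigr => i iJ; rewrite /B'; case: eqP => // ik; rewrite -ik iJ in kJ.
  transitivity (\int[P]_(w in D (k |: J)%SET B') (\prod_(i <- s) f i (X i w))%:E)%E.
    rewrite DE integral_mkcondr; apply: eq_integral => w _.
    by rewrite epatch_indic /= -EFinM mulrC.
  rewrite IH//; last first.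
    move=> i is_; rewrite in_setU1 negb_or sJ ?inE ?is_ ?orbT// andbT.
    by apply: contraNneq ks => <-.
  by rewrite PE EFinM fineK// -muleA; congr (_ * _)%E; rewrite muleC.
have := gen (index_enum I) (index_enum_uniq I) finset.set0 (fun=> setT).
have -> : D finset.set0 (fun=> setT) = setT.
  by apply/seteqP; split => w //= _ i.
by rewrite probability_setT mule1; apply => [i|i _]; [exact: measurableT | rewrite finset.in_set0].
Qed.

(** * Hoeffding's inequality *)

(** From exp(-x/2) >= 1 - x/2 follows exp(x) (1 - x/2)^2 <= 1, while (1 + x + x^2) (1 - x/2)^2
    exceeds 1 by (x/2)^2 (1 - 3x + x^2), which is nonnegative for x <= 1/3. *)
Lemma expR_le_1DxDsqr (R : realType) (x : R) :
  x <= 3^-1 -> expR x <= 1 + x + x ^+ 2.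
Proof.
move=> hx; have h1 : 0 < 1 - x / 2 by lra.
have h2 : 1 - x / 2 <= expR (- (x / 2)).
  by have := expR_ge1Dx (- (x / 2)); lra.
have h3 : expR x * (1 - x / 2) ^+ 2 <= 1.
  rewrite [leRHS](_ : _ = expR x * expR (- (x / 2)) ^+ 2).
    by rewrite ler_wpM2l ?expR_ge0// ler_sqr ?nnegrE ?expR_ge0// ltW.
  by rewrite -expRM_natl -expRD [_ + _](_ : _ = 0) ?expR0//; field.
have h4 : 1 <= (1 + x + x ^+ 2) * (1 - x / 2) ^+ 2.
  rewrite -subr_ge0.
  rewrite [leRHS](_ : _ = (x / 2) ^+ 2 * (1 - 3 * x + x ^+ 2)); last by field.
  by apply: mulr_ge0; [exact: sqr_ge0 | nra].
by rewrite -(ler_pM2r (exprn_gt0 2 h1)); exact: le_trans h3 h4.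
Qed.

(** The linear term is kept apart because it integrates to zero for a centred variable, leaving a
    sub-Gaussian factor. Up to 1/3 the quadratic bound suffices; beyond it x <= 3 x^2. *)
Lemma expR_le_DexpR_sqr (R : realType) (x : R) :
  expR x <= x + expR (3 * x ^+ 2).
Proof.
have [hx|hx] := leP x 3^-1.
  have := expR_le_1DxDsqr hx; have := expR_ge1Dx (3 * x ^+ 2).
  by have := sqr_ge0 x; lra.
have : expR x <= expR (3 * x ^+ 2) by rewrite ler_expR; nra.
by lra.
Qed.

Lemma ae_exists d (T : measurableType d) (R : realType) (P : probability T R)
  (Q : T -> Prop) : {ae P, forall w, Q w} -> exists w, Q w.
Proof.
move=> [N [mN PN0 subN]]; apply: contrapT => /forallNP nQ.
have NT : N = setT by apply/seteqP; split => // w _; apply: subN; exact: nQ.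
by move: PN0; rewrite NT probability_setT => /eqP; rewrite onee_eq0.
Qed.

Section Hoeffding.
Context d (T : measurableType d) (R : realType) (P : probability T R).

Lemma integrable_of_bounded (f : T -> R) (D : R) :
  measurable_fun [set: T] f -> (forall w, `|f w| <= D) ->
  P.-integrable [set: T] (EFin \o f).
Proof.
move=> mf fD; apply: measurable_bounded_integrable => //.
  by rewrite /= probability_setT ltry.
exists D; split; first exact: num_real.
by move=> M DM w _; exact: le_trans (fD w) (ltW DM).
Qed.

Lemma mgf_centered_le (Z : T -> R) (D l : R) :
  measurable_fun [set: T] Z -> (forall w, `|Z w| <= D) ->
  (\int[P]_w (Z w)%:E = 0)%E ->
  (\int[P]_w (expR (l * Z w))%:E <= (expR (3 * (l * D) ^+ 2))%:E)%E.
Proof.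
move=> mZ ZD EZ.
have mlZ : measurable_fun [set: T] (fun w => l * Z w) by exact: measurable_funM.
have lZD w : `|l * Z w| <= `|l| * D by rewrite normrM ler_wpM2l.
have ilZ : P.-integrable [set: T] (EFin \o (fun w => l * Z w)).
  exact: (integrable_of_bounded mlZ lZD).
have mexp : measurable_fun [set: T] (fun w => expR (l * Z w)).
  exact: measurableT_comp.
apply: (@le_trans _ _ (\int[P]_w ((l * Z w)%:E + (expR (3 * (l * D) ^+ 2))%:E))%E).
  apply: le_integral => //.
  - apply: (@integrable_of_bounded _ (expR (`|l| * D))) => // w.
    by rewrite ger0_norm ?expR_ge0// ler_expR (le_trans (ler_norm _)).
  - by apply: integrableD => //; exact: finite_measure_integrable_cst.
  - move=> w _; rewrite -EFinD lee_fin (le_trans (expR_le_DexpR_sqr _))//.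
    rewrite lerD2l ler_expR ler_wpM2l// -[leLHS]real_normK ?num_real//.
    have D0 : 0 <= D by exact: le_trans (ZD w).
    rewrite [leRHS](_ : _ = (`|l| * D) ^+ 2).
      by rewrite ler_sqr ?nnegrE ?mulr_ge0.
    by rewrite !exprMn real_normK ?num_real.
rewrite integralD//; last exact: finite_measure_integrable_cst.
rewrite integral_cst//= probability_setT mule1.
under eq_integral do rewrite EFinM.
rewrite integralZl//; last exact: (integrable_of_bounded mZ ZD).
by rewrite EZ mule0 add0e.
Qed.

(** Chernoff's method: Markov's inequality for the exponential, factorisation by independence, the
    moment bound for each centred factor, and the best exponent. *)
Lemma hoeffding_tail (I : finType) (X : I -> {RV P >-> R}) (a b : R)
    (mu t : I -> R) (tau : R) :
  0 < a -> a <= b -> mutually_independent X ->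
  (forall i, {ae P, forall w, a <= X i w <= b}) ->
  (forall i, ((mu i)%:E = 'E_P[X i])%E) ->
  \sum_i t i ^+ 2 <= 1 -> 0 <= tau ->
  (P [set w | (tau < \sum_i t i * (X i w - mu i))%R]
     <= (expR (- (tau ^+ 2 / (12 * b ^+ 2))))%:E)%E.
Proof.
move=> a0 ab indep Xab Emu t1 tau0.
have b0 : 0 < b by exact: lt_le_trans ab.
(* The bounds on [X i] hold only almost surely. Truncation makes them hold everywhere without
   changing the mean and, being a function of [X i], preserves independence. *)
pose clip (x : R) := Num.max a (Num.min x b).
have clip_bnd x : a <= clip x <= b.
  by rewrite /clip le_max lexx /= ge_max ab /= ge_min lexx orbT.
have clip_id x : a <= x <= b -> clip x = x.
  by move=> /andP[ax xb]; rewrite /clip min_l// max_r.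
have mclip : measurable_fun [set: R] clip.
  apply: measurable_maxr; first exact: measurable_cst.
  by apply: measurable_minr; [exact: measurable_id | exact: measurable_cst].
have mX i : measurable_fun [set: T] (X i) by exact: measurable_funPT.
have mcX i : measurable_fun [set: T] (fun w => clip (X i w)).
  by apply: measurableT_comp.
have icX i : P.-integrable [set: T] (EFin \o (fun w => clip (X i w))).
  apply: (@integrable_of_bounded _ b) => // w.
  have /andP[h1 h2] := clip_bnd (X i w).
  by rewrite ger0_norm// (le_trans (ltW a0)).
have Eclip i : (\int[P]_w (clip (X i w))%:E = (mu i)%:E)%E.
  rewrite Emu expectation_def; apply: ae_eq_integral => //.
  - exact/measurable_EFinP.
  - exact/measurable_EFinP.
  - by apply: filterS (Xab i) => w /clip_id -> _.
have mu_bnd i : a <= mu i <= b.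
  rewrite -!lee_fin -Eclip; apply/andP; split.
    rewrite -[leLHS]mule1 -(probability_setT P) -integral_cst//.
    apply: le_integral; [by []|exact: finite_measure_integrable_cst|exact: icX|].
    by move=> w _; rewrite lee_fin; case/andP: (clip_bnd (X i w)).
  rewrite -[leRHS]mule1 -(probability_setT P) -integral_cst//.
  apply: le_integral; [by []|exact: icX|exact: finite_measure_integrable_cst|].
  by move=> w _; rewrite lee_fin; case/andP: (clip_bnd (X i w)).
(* The minimiser of 3 (l b)^2 - l tau, the exponent left after multiplying the factors; the minimum
   is - tau^2 / (12 b^2). *)
pose l := tau / (6 * b ^+ 2).
have l0 : 0 <= l by rewrite divr_ge0// mulr_ge0// sqr_ge0.
pose f i x := expR (l * t i * (clip x - mu i)).
have mf i : measurable_fun [set: R] (f i).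
  apply: measurableT_comp => //; apply: measurable_funM => //.
  exact: measurable_funB.
have Zb i w : `|clip (X i w) - mu i| <= b.
  have /andP[h1 h2] := clip_bnd (X i w); have /andP[h3 h4] := mu_bnd i.
  by rewrite ler_norml; apply/andP; split; lra.
have Ef i : (\int[P]_w (f i (X i w))%:E <= (expR (3 * (l * t i * b) ^+ 2))%:E)%E.
  apply: mgf_centered_le => //; first exact: measurable_funB.
  under eq_integral do rewrite EFinB.
  rewrite integralB_EFin//; last exact: finite_measure_integrable_cst.
  by rewrite Eclip integral_cst//= probability_setT mule1 subee.
have Ef_fin i : (\int[P]_w (f i (X i w))%:E)%E \is a fin_num.
  rewrite ge0_fin_numE ?(le_lt_trans (Ef i)) ?ltry//.
  by apply: integral_ge0 => w _; rewrite lee_fin expR_ge0.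
have EY := expectation_prod_indep indep mf (fun i x => expR_ge0 _)
  (fun i => esym (fineK (Ef_fin i))).
set A := [set w | _].
have mA : measurable A.
  rewrite -[A]setTI; apply: (@measurable_fun_ltr _ _ _ _ (cst tau)) => //.
  apply: measurable_sum => i; apply: measurable_funM => //.
  exact: measurable_funB.
have markov : ((expR (l * tau))%:E * P A <= \int[P]_w (\prod_i f i (X i w))%:E)%E.
  have -> : P A = (\int[P]_w (\1_A w)%:E)%E by rewrite integral_indic// setIT.
  rewrite -ge0_integralZl//; first last.
  - by apply/measurable_EFinP; exact: measurable_indic.
  apply: ae_ge0_le_integral => //.
  - apply: emeasurable_funM => //; apply/measurable_EFinP.
    exact: measurable_indic.
  - by move=> w _; rewrite lee_fin prodr_ge0// => i _; rewrite expR_ge0.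
  - apply/measurable_EFinP; apply: measurable_prod => i _.
    by apply: measurableT_comp; [exact: mf | exact: mX].
  have Xab' : {ae P, forall w, forall i, a <= X i w <= b}.
    exact: filter_forall.
  apply: filterS Xab' => w Xw _ /=; rewrite -EFinM lee_fin indicE.
  case: (boolP (w \in A)) => [|_]; last first.
    by rewrite mulr0 prodr_ge0// => i _; rewrite expR_ge0.
  rewrite inE mulr1 -expR_sum ler_expR => Aw.
  rewrite (eq_bigr (fun i => l * (t i * (X i w - mu i)))); last first.
    by move=> i _; rewrite clip_id// mulrA.
  by rewrite -mulr_sumr ler_wpM2l// ltW.
have Eprod : (\int[P]_w (\prod_i f i (X i w))%:E <= (expR (3 * (l * b) ^+ 2))%:E)%E.
  rewrite EY lee_fin.
  apply: (@le_trans _ _ (\prod_i expR (3 * (l * t i * b) ^+ 2))).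
    apply: ler_prod => i _; rewrite fine_ge0 ?integral_ge0//=; last first.
      by move=> w _; rewrite lee_fin expR_ge0.
    by rewrite -lee_fin fineK.
  rewrite -expR_sum ler_expR -mulr_sumr ler_wpM2l//.
  rewrite (eq_bigr (fun i => (l * b) ^+ 2 * t i ^+ 2)); last by move=> i _; ring.
  by rewrite -mulr_sumr ler_piMr// sqr_ge0.
have -> : - (tau ^+ 2 / (12 * b ^+ 2)) = 3 * (l * b) ^+ 2 - l * tau.
  by rewrite /l; field; rewrite gt_eqF.
rewrite expRD expRN EFinM lee_pdivlMr ?expR_gt0// muleC.
exact: le_trans markov Eprod.
Qed.
End Hoeffding.

(** * Stability of matrix scaling *)

Section WeightedAverage.
Context (R : realFieldType) (I J : finType) (B : I -> J -> R) (y : J -> R).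
Context (a b : R) (a0 : 0 < a) (Bab : forall i j, a <= B i j <= b).
Context (y0 : forall j, 0 < y j).

Lemma row_sum_bounds (i : I) :
  a * \sum_j y j <= \sum_j B i j * y j <= b * \sum_j y j.
Proof.
rewrite !mulr_sumr; apply/andP; split; apply: ler_sum => j _;
  by case/andP: (Bab i j) => ? ?; rewrite ler_wpM2r// ltW.
Qed.

(* Every row of weights dominates the common measure (a / b) y / sum y; this is
   Doeblin's condition and yields the contraction factor 1 - a / b. *)
Lemma row_average_ratio (v : J -> R) (V : R) (j0 : J) (i i' : I) :
  (forall j, v j0 <= v j <= V * v j0) -> 0 < v j0 ->
  (\sum_j B i' j * y j * v j) * (\sum_j B i j * y j) <=
  (1 + (1 - a / b) * (V - 1)) *
    ((\sum_j B i j * y j * v j) * (\sum_j B i' j * y j)).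
Proof.
move=> vb vj0.
have Y0 : 0 < \sum_j y j.
  rewrite (bigD1 j0)//= ltr_pwDl//; apply: sumr_ge0 => j _; exact: ltW.
have b0 : 0 < b.
  by case/andP: (Bab i j0) => h1 h2; apply: lt_le_trans a0 (le_trans h1 h2).
have ab : a <= b by case/andP: (Bab i j0) => h1 h2; exact: le_trans h2.
have T0 k : 0 < \sum_j B k j * y j.
  by case/andP: (row_sum_bounds k) => + _; apply: lt_le_trans; exact: mulr_gt0.
set k := a / b.
have k0 : 0 < k by exact: divr_gt0.
have k1 : k <= 1 by rewrite ler_pdivrMr// mul1r.
have V1 : 1 <= V.
  by case/andP: (vb j0) => _; rewrite -[leLHS]mul1r ler_pM2r.
(* The average of [v] for the common measure y / sum y, the part shared by all rows. *)
pose vh := (\sum_j y j * v j) / \sum_j y j.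
have vh1 : v j0 <= vh.
  rewrite ler_pdivlMr// mulr_sumr; apply: ler_sum => j _; rewrite mulrC.
  by rewrite ler_pM2l//; case/andP: (vb j).
(* The minorisation: an entry is at least [a] and a row total at most b sum y, so every row average
   of a nonnegative [z] is at least [k] times its common average. It is applied below to v - v j0
   and to V v j0 - v. *)
have key (l : I) (z : J -> R) : (forall j, 0 <= z j) ->
    k * (\sum_j y j * z j) / (\sum_j y j) * (\sum_j B l j * y j) <=
    \sum_j B l j * y j * z j.
  move=> z0; case/andP: (row_sum_bounds l) => _ Tb.
  have S0 : 0 <= \sum_j y j * z j.
    by apply: sumr_ge0 => j _; rewrite mulr_ge0// ltW.
  apply: (@le_trans _ _ (a * \sum_j y j * z j)).
    rewrite [leLHS](_ : _ = (a * \sum_j y j * z j) *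
      ((\sum_j B l j * y j) / (b * \sum_j y j))).
      by rewrite ler_piMr ?mulr_ge0 ?(ltW a0)// ler_pdivrMr ?mulr_gt0// mul1r.
    by rewrite /k; field; rewrite !gt_eqF.
  rewrite mulr_sumr; apply: ler_sum => j _; rewrite mulrA ler_wpM2r//.
  by rewrite ler_wpM2r ?(ltW (y0 j))//; case/andP: (Bab l j).
pose D := (1 - k) * v j0 + k * vh.
have vhE : vh * (\sum_j y j) = \sum_j y j * v j by rewrite mulfVK ?gt_eqF.
have split1 (w : J -> R) c :
    \sum_j w j * (v j - c) = \sum_j w j * v j - c * \sum_j w j.
  by rewrite mulr_sumr -sumrB; apply: eq_bigr => j _; ring.
have split2 (w : J -> R) c :
    \sum_j w j * (c - v j) = c * \sum_j w j - \sum_j w j * v j.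
  by rewrite mulr_sumr -sumrB; apply: eq_bigr => j _; ring.
have lo : D * (\sum_j B i j * y j) <= \sum_j B i j * y j * v j.
  have := key i (fun j => v j - v j0).
  rewrite !split1 -vhE -mulrBl mulrA mulfK ?gt_eqF// => h.
  have /h : forall j, 0 <= v j - v j0 by move=> j; rewrite subr_ge0; case/andP: (vb j).
  by rewrite /D; lra.
have hi : \sum_j B i' j * y j * v j <=
    ((1 - k) * (V * v j0) + k * vh) * (\sum_j B i' j * y j).
  have := key i' (fun j => V * v j0 - v j).
  rewrite !split2 -vhE -mulrBl mulrA mulfK ?gt_eqF// => h.
  have /h : forall j, 0 <= V * v j0 - v j by move=> j; rewrite subr_ge0; case/andP: (vb j).
  by lra.
(* The shared term [k * vh] occurs in both bounds, hence only the share 1 - k of the oscillation V -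
   1 survives in their quotient. *)
have DV : (1 - k) * (V * v j0) + k * vh <= (1 + (1 - k) * (V - 1)) * D.
  rewrite -subr_ge0 [leRHS](_ : _ = (1 - k) * (V - 1) * (k * (vh - v j0))).
    by apply: mulr_ge0; apply: mulr_ge0; rewrite ?subr_ge0 // ltW.
  by rewrite /D; ring.
have c0 : 0 <= 1 + (1 - k) * (V - 1).
  by rewrite addr_ge0// mulr_ge0// subr_ge0.
apply: (le_trans (ler_wpM2r (ltW (T0 i)) hi)).
rewrite mulrAC; apply: (le_trans (ler_wpM2r (ltW (T0 i')) (ler_wpM2r (ltW (T0 i)) DV))).
by rewrite !mulrA ler_wpM2r ?(ltW (T0 i'))// -!mulrA ler_wpM2l.
Qed.

(** Up to factors 1 - e and 1 + e, the row equations make [u i] the reciprocal of a weighted average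
    of [v], so the oscillation of [u] is bounded by the contracted oscillation of [v]. The factor 1
    + 4 e bounds (1 + e) / (1 - e) for e <= 1/2. *)
Lemma row_ratio_contraction (u : I -> R) (v : J -> R) (e V : R) (j0 : J) :
  0 <= e -> e <= 2^-1 -> (forall i, 0 < u i) ->
  (forall j, v j0 <= v j <= V * v j0) -> 0 < v j0 ->
  (forall i, (1 - e) * (u i * \sum_j B i j * y j * v j) <= \sum_j B i j * y j
             <= (1 + e) * (u i * \sum_j B i j * y j * v j)) ->
  forall i i', u i <= (1 + 4 * e) * (1 + (1 - a / b) * (V - 1)) * u i'.
Proof.
move=> e0 e2 u0 vb vj0 H i i'.
have T0 k : 0 < \sum_j B k j * y j.
  rewrite (bigD1 j0)//= ltr_pwDl//; first exact: mulr_gt0 (lt_le_trans a0 (proj1 (andP (Bab k j0)))) _.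
  apply: sumr_ge0 => j _; apply: mulr_ge0 (ltW (y0 j)).
  by case/andP: (Bab k j) => h _; exact: le_trans (ltW a0) h.
have W0 k : 0 < \sum_j B k j * y j * v j.
  have := T0 k; case/andP: (H k) => _ h /lt_le_trans /(_ h).
  by rewrite pmulr_rgt0 ?pmulr_rgt0//; lra.
have := row_average_ratio i i' vb vj0.
case/andP: (H i) => h1 _; case/andP: (H i') => _ h2.
have := T0 i; have := T0 i'; have := W0 i; have := W0 i'; move: h1 h2.
have := u0 i; have := u0 i'.
set Wi := \sum_j B i j * y j * v j; set Wi' := \sum_j B i' j * y j * v j.
set Ti := \sum_j B i j * y j; set Ti' := \sum_j B i' j * y j.
set c := 1 + (1 - a / b) * (V - 1) => ui' ui h1 h2 Wi'0 Wi0 Ti'0 Ti0 h3.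
have c0 : 0 < c.
  by move: (lt_le_trans (mulr_gt0 Wi'0 Ti0) h3); rewrite (pmulr_lgt0 _ (mulr_gt0 Wi0 Ti'0)).
have h4 : (1 - e) * u i <= c * ((1 + e) * u i').
  rewrite -(ler_pM2r (mulr_gt0 Wi0 Wi'0)).
  apply: (@le_trans _ _ (Wi' * Ti)).
    rewrite [leLHS](_ : _ = Wi' * ((1 - e) * (u i * Wi))); last by ring.
    by rewrite ler_pM2l.
  apply: (le_trans h3).
  rewrite [leRHS](_ : _ = c * (Wi * ((1 + e) * (u i' * Wi')))); last by ring.
  by rewrite !ler_pM2l.
rewrite -(@ler_pM2l _ (1 - e)); last by lra.
apply: (le_trans h4).
rewrite [leLHS](_ : _ = (1 + e) * (c * u i')); last by ring.
rewrite [leRHS](_ : _ = (1 - e) * (1 + 4 * e) * (c * u i')); last by ring.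
by rewrite ler_pM2r ?mulr_gt0//; nra.
Qed.

End WeightedAverage.

(** * Oscillation of approximate scaling factors *)

Section Stability.
Context (R : realFieldType) (I J : finType).
Context (a b : R) (a0 : 0 < a).

(** The a priori bound [V0] makes both inequalities linear: U - 1 <= 4 e V0 + (1 - k) (V - 1), and
    likewise with U and V exchanged. Their sum gives k (U - 1) + k (V - 1) <= 8 V0 e. *)
Lemma contraction_fixpoint (U V V0 e k : R) :
  0 <= e -> e <= 2^-1 -> 0 < k -> k <= 1 -> 1 <= U -> 1 <= V ->
  U <= V0 -> V <= V0 ->
  U <= (1 + 4 * e) * (1 + (1 - k) * (V - 1)) ->
  V <= (1 + 4 * e) * (1 + (1 - k) * (U - 1)) ->
  V - 1 <= 8 * V0 / k * e.
Proof.
move=> e0 e2 k0 k1 U1 V1 UV0 VV0 hU hV.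
have hU' : U - 1 <= 4 * e * V0 + (1 - k) * (V - 1) by nra.
have hV' : V - 1 <= 4 * e * V0 + (1 - k) * (U - 1) by nra.
have h : k * (U - 1) + k * (V - 1) <= 8 * V0 * e by lra.
rewrite mulrAC ler_pdivlMr//.
have : 0 <= k * (U - 1) by rewrite mulr_ge0 ?subr_ge0// ltW.
by lra.
Qed.

(** In the application [u] and [v] are the correction factors x' / x and y' / y, and [V0] is a crude
    bound on their oscillation. Rows bound the oscillation of [u] by that of [v], columns
    conversely, and the contraction closes the loop. Once [v] is nearly constant, row [i] alone
    forces [u i * v j] close to 1. *)
Lemma approximate_scaling_stability (B : I -> J -> R) (x u : I -> R)
    (y v : J -> R) (e V0 : R) (i : I) (j : J) :
  (forall i j, a <= B i j <= b) ->
  (forall i, 0 < x i) -> (forall j, 0 < y j) ->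
  (forall i, 0 < u i) -> (forall j, 0 < v j) ->
  (forall i k, u i <= V0 * u k) -> (forall j k, v j <= V0 * v k) ->
  0 <= e -> e <= 2^-1 ->
  (forall i, (1 - e) * (u i * \sum_j B i j * y j * v j) <= \sum_j B i j * y j
             <= (1 + e) * (u i * \sum_j B i j * y j * v j)) ->
  (forall j, (1 - e) * (v j * \sum_i B i j * x i * u i) <= \sum_i B i j * x i
             <= (1 + e) * (v j * \sum_i B i j * x i * u i)) ->
  `|u i * v j - 1| <= (8 * V0 / (a / b) + 2 * V0) * e.
Proof.
move=> Bab x0 y0 u0 v0 uV0 vV0 e0 e2 Hr Hc.
have /andP[aB Bb] := Bab i j.
have b0 : 0 < b by apply: lt_le_trans a0 (le_trans aB Bb).
pose i0 := [arg min_(k < i) u k]%O; pose i1 := [arg max_(k > i) u k]%O.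
pose j0 := [arg min_(k < j) v k]%O; pose j1 := [arg max_(k > j) v k]%O.
have ui0 k : u i0 <= u k by rewrite /i0; case: arg_minP => // l _; apply.
have ui1 k : u k <= u i1 by rewrite /i1; case: arg_maxP => // l _; apply.
have vj0 k : v j0 <= v k by rewrite /j0; case: arg_minP => // l _; apply.
have vj1 k : v k <= v j1 by rewrite /j1; case: arg_maxP => // l _; apply.
pose U := u i1 / u i0; pose V := v j1 / v j0.
have UE : U * u i0 = u i1 by rewrite mulfVK ?gt_eqF.
have VE : V * v j0 = v j1 by rewrite mulfVK ?gt_eqF.
have U1 : 1 <= U by rewrite ler_pdivlMr// mul1r.
have V1 : 1 <= V by rewrite ler_pdivlMr// mul1r.
have UV0 : U <= V0 by rewrite ler_pdivrMr.
have VV0 : V <= V0 by rewrite ler_pdivrMr.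
have hU : U <= (1 + 4 * e) * (1 + (1 - a / b) * (V - 1)).
  rewrite ler_pdivrMr//.
  apply: (row_ratio_contraction a0 Bab y0 e0 e2 u0 (j0 := j0) (v := v)) => //.
  by move=> k; rewrite VE vj0 vj1.
have hV : V <= (1 + 4 * e) * (1 + (1 - a / b) * (U - 1)).
  rewrite ler_pdivrMr//.
  apply: (row_ratio_contraction a0 (B := fun j i => B i j) _ x0 e0 e2 v0
    (j0 := i0) (v := u)) => //.
  by move=> k; rewrite UE ui0 ui1.
have V0_ge1 : 1 <= V0 by exact: le_trans UV0.
have eta : V - 1 <= 8 * V0 / (a / b) * e.
  apply: contraction_fixpoint hU hV => //; first exact: divr_gt0.
  by rewrite ler_pdivrMr// mul1r; exact: le_trans Bb.
have vlo k : v j <= V * v k.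
  by apply: (le_trans (vj1 j)); rewrite -VE ler_wpM2l// (le_trans ler01).
have vhi k : v k <= V * v j.
  by apply: (le_trans (vj1 k)); rewrite -VE ler_wpM2l// (le_trans ler01).
have T0 : 0 < \sum_j B i j * y j.
  rewrite (bigD1 j)//= ltr_pwDl ?(mulr_gt0 (lt_le_trans a0 aB))//.
  apply: sumr_ge0 => k _; apply: mulr_ge0 (ltW (y0 k)).
  by case/andP: (Bab i k) => h _; exact: le_trans (ltW a0) h.
(* Replacing every [v k] in row [i] by the single value [v j] costs at most a factor [V] in either
   direction. *)
have W1 : \sum_j B i j * y j * v j <= V * v j * \sum_j B i j * y j.
  rewrite mulr_sumr; apply: ler_sum => k _.
  have /andP[h _] := Bab i k.
  rewrite [leRHS]mulrC ler_wpM2l// mulr_ge0 ?(ltW (y0 k))//.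
  exact: le_trans (ltW a0) h.
have W2 : v j * (\sum_j B i j * y j) <= V * \sum_j B i j * y j * v j.
  rewrite !mulr_sumr; apply: ler_sum => k _.
  have /andP[h _] := Bab i k.
  rewrite mulrC mulrCA ler_wpM2l// mulr_ge0 ?(ltW (y0 k))//.
  exact: le_trans (ltW a0) h.
have /andP[h1 h2] := Hr i.
move: T0 W1 W2 h1 h2; set W := \sum_j _ * _ * _; set Ti := \sum_j _ => T0 W1 W2 h1 h2.
have uv0 : 0 < u i * v j by exact: mulr_gt0.
have lo : 1 <= (1 + e) * V * (u i * v j).
  rewrite -(ler_pM2r T0) mul1r; apply: (le_trans h2).
  rewrite [leRHS](_ : _ = (1 + e) * (u i * (V * v j * Ti))); last by ring.
  by rewrite ler_wpM2l ?addr_ge0// ler_wpM2l// ltW.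
have hi : (1 - e) * (u i * v j) <= V.
  rewrite -(ler_pM2r T0).
  rewrite [leLHS](_ : _ = (1 - e) * u i * (v j * Ti)); last by ring.
  apply: (@le_trans _ _ ((1 - e) * u i * (V * W))).
    by rewrite ler_wpM2l// mulr_ge0 ?(ltW (u0 i))//; lra.
  rewrite [leLHS](_ : _ = V * ((1 - e) * (u i * W))); last by ring.
  by rewrite ler_wpM2l// (le_trans ler01).
move: uv0 lo hi eta; set z := u i * v j; set K := 8 * V0 / _ => uv0 lo hi eta.
have hi' : z <= V * (1 + 2 * e).
  rewrite -(@ler_pM2l _ (1 - e)); last by lra.
  apply: (le_trans hi); rewrite mulrCA ler_peMr ?(le_trans ler01)//; nra.
(* With q = (1 + e) V, the bound [lo] reads z >= 1/q, and 1/q >= 2 - q. *)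
have lo' : 2 - (1 + e) * V <= z.
  have q0 : 0 < (1 + e) * V by apply: mulr_gt0; [lra | exact: lt_le_trans V1].
  rewrite -subr_ge0 -(pmulr_rge0 _ q0).
  rewrite [leRHS](_ : _ = ((1 + e) * V * z - 1) + ((1 + e) * V - 1) ^+ 2); last by ring.
  by rewrite addr_ge0 ?subr_ge0 ?sqr_ge0.
have eV : e * V <= e * V0 by rewrite ler_wpM2l.
have eV0 : 0 <= e * V0 by rewrite mulr_ge0// (le_trans ler01).
by rewrite ler_norml; apply/andP; split; lra.
Qed.
End Stability.

(** * A priori bounds and stability of exact scalings *)

Section RowBounds.
Context (R : realFieldType) (I J : finType) (a b : R).

Lemma row_scale_bounds (A : I -> J -> R) (x : I -> R) (y : J -> R) (i : I) :
  (forall i j, a <= A i j <= b) -> (forall i, 0 < x i) -> (forall j, 0 < y j) ->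
  x i * (a * \sum_j y j) <= \sum_j x i * A i j * y j <= x i * (b * \sum_j y j).
Proof.
move=> Aab x0 y0.
have -> : \sum_j x i * A i j * y j = x i * \sum_j A i j * y j.
  by rewrite mulr_sumr; apply: eq_bigr => j _; rewrite mulrA.
by rewrite !ler_pM2l//; exact: row_sum_bounds.
Qed.

End RowBounds.

Section ScalingStability.
Context (R : realFieldType) (I J : finType).
Context (a b : R) (r : I -> R) (c : J -> R) (a0 : 0 < a).

Definition scales_fun (A : I -> J -> R) (x : I -> R) (y : J -> R) :=
  [/\ forall i, 0 < x i, forall j, 0 < y j,
      forall i, \sum_j x i * A i j * y j = r i &
      forall j, \sum_i x i * A i j * y j = c j].

(** With entries in [a, b], row [i] determines [x i] as r_i / sum y up to the constants [a] and [b],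
    and columns do the same for [y j]; the last bound sums the row bounds. *)
Lemma scale_bounds (A : I -> J -> R) (x : I -> R) (y : J -> R) :
  (forall i j, a <= A i j <= b) -> scales_fun A x y ->
  [/\ forall i, x i * (a * \sum_j y j) <= r i <= x i * (b * \sum_j y j),
      forall j, y j * (a * \sum_i x i) <= c j <= y j * (b * \sum_i x i) &
      \sum_i r i <= b * (\sum_i x i) * (\sum_j y j)].
Proof.
move=> Aab [x0 y0 xr yc].
have h1 i : x i * (a * \sum_j y j) <= r i <= x i * (b * \sum_j y j).
  by rewrite -xr; exact: row_scale_bounds.
split=> // [j|].
  have := @row_scale_bounds _ _ _ a b (fun j i => A i j) y x j
    (fun j i => Aab i j) y0 x0.
  have -> // : \sum_i y j * A i j * x i = c j.
  by rewrite -yc; apply: eq_bigr => i _; ring.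
rewrite mulrAC mulrC mulr_suml; apply: ler_sum => i _.
by case/andP: (h1 i).
Qed.

(** With X = sum x and Y = sum y, multiplying the lower row and column bounds gives a^2 x_i y_j X Y
    <= r_i c_j, while b X Y is at least the total mass. *)
Lemma scaled_entry_le (A : I -> J -> R) (x : I -> R) (y : J -> R) (i : I) (j : J) :
  (forall i j, a <= A i j <= b) -> scales_fun A x y ->
  x i * y j <= b / a ^+ 2 * (r i * c j / \sum_i r i).
Proof.
move=> Aab sc; have [h1 h2 h3] := scale_bounds Aab sc.
have [x0 y0 _ _] := sc.
have X0 : 0 < \sum_i x i.
  rewrite (bigD1 i)//= ltr_pwDl//; apply: sumr_ge0 => k _; exact: ltW.
have Y0 : 0 < \sum_j y j.
  rewrite (bigD1 j)//= ltr_pwDl//; apply: sumr_ge0 => k _; exact: ltW.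
have r0 k : 0 < r k.
  by case/andP: (h1 k) => + _; apply: lt_le_trans; rewrite !mulr_gt0.
have s0 : 0 < \sum_i r i.
  rewrite (bigD1 i)//= ltr_pwDl//; apply: sumr_ge0 => k _; exact: ltW.
rewrite [leRHS](_ : _ = b * (r i * c j) / (a ^+ 2 * \sum_i r i)); last first.
  by field; rewrite !gt_eqF.
rewrite ler_pdivlMr ?mulr_gt0 ?exprn_gt0//.
have /andP[p1 _] := h1 i; have /andP[p2 _] := h2 j.
have p3 : (x i * (a * \sum_j y j)) * (y j * (a * \sum_i x i)) <= r i * c j.
  by apply: ler_pM => //; rewrite !mulr_ge0// ltW.
have b0 : 0 <= b.
  by case/andP: (Aab i j) => q1 q2; exact: le_trans (ltW a0) (le_trans q1 q2).
apply: le_trans (ler_wpM2l b0 p3).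
apply: (@le_trans _ _ (x i * y j * (a ^+ 2 * (b * (\sum_i x i) * (\sum_j y j))))).
  by rewrite !ler_pM2l ?mulr_gt0 ?exprn_gt0.
by rewrite le_eqVlt; apply/orP; left; apply/eqP; ring.
Qed.

(** The correction factors x' / x and y' / y satisfy approximate scaling equations with relative
    error [e]. Their oscillation is at most (b / a)^2 a priori, and 8 (b / a)^3 + 2 (b / a)^2 <= 10
    (b / a)^3; the rest of the constant bounds x_i y_j. *)
Lemma scaling_stability (A B : I -> J -> R) (x x' : I -> R) (y y' : J -> R)
    (e : R) (i : I) (j : J) :
  (forall i j, a <= A i j <= b) -> (forall i j, a <= B i j <= b) ->
  scales_fun A x y -> scales_fun B x' y' -> 0 <= e ->
  (forall i, `|x i * \sum_j (B i j - A i j) * y j| <= e * r i) ->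
  (forall j, `|y j * \sum_i (B i j - A i j) * x i| <= e * c j) ->
  `|x' i * y' j - x i * y j| <=
    10 * (b / a) ^+ 3 * (b / a ^+ 2) * e * (r i * c j / \sum_i r i).
Proof.
move=> Aab Bab sA sB e0 Hr Hc.
have [x0 y0 xr yc] := sA; have [x'0 y'0 xr' yc'] := sB.
have [h1 h2 h3] := scale_bounds Aab sA; have [h1' h2' h3'] := scale_bounds Bab sB.
have /andP[aB Bb] := Bab i j.
have ab : a <= b := le_trans aB Bb.
have b0 : 0 < b := lt_le_trans a0 ab.
have pos (z : I -> R) : (forall i, 0 < z i) -> 0 < \sum_i z i.
  move=> z0; rewrite (bigD1 i)//= ltr_pwDl//; apply: sumr_ge0 => k _; exact: ltW.
have pos' (z : J -> R) : (forall i, 0 < z i) -> 0 < \sum_i z i.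
  move=> z0; rewrite (bigD1 j)//= ltr_pwDl//; apply: sumr_ge0 => k _; exact: ltW.
have X0 := pos _ x0; have X'0 := pos _ x'0; have Y0 := pos' _ y0; have Y'0 := pos' _ y'0.
have exy := scaled_entry_le i j Aab sA; have exy' := scaled_entry_le i j Bab sB.
set q := r i * c j / _ in exy exy' *.
have q0 : 0 <= q.
  have /(lt_le_trans (mulr_gt0 (x0 i) (y0 j))) := exy.
  have C0 : 0 < b / a ^+ 2 by rewrite divr_gt0 ?exprn_gt0.
  by rewrite (pmulr_rgt0 _ C0); exact: ltW.
set k := b / a.
have k1 : 1 <= k by rewrite ler_pdivlMr// mul1r.
have k3 : 1 <= k ^+ 3 by exact: exprn_ege1.
have C0 : 0 <= b / a ^+ 2 by rewrite divr_ge0 ?exprn_ge0// ltW.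
(* For e > 1/2 the claim is crude: both products lie between 0 and b / a^2 * q, and 10 k^3 e >=
   5. *)
have [e2|e2] := leP e 2^-1; last first.
  apply: (@le_trans _ _ (b / a ^+ 2 * q)).
    have := mulr_gt0 (x0 i) (y0 j); have := mulr_gt0 (x'0 i) (y'0 j).
    by rewrite ler_norml => ? ?; apply/andP; split; lra.
  rewrite -[leLHS]mul1r [leRHS](_ : _ = 10 * k ^+ 3 * e * (b / a ^+ 2 * q)); last by ring.
  rewrite (ler_wpM2r (mulr_ge0 C0 q0))//.
  have : 1 * 2^-1 <= k ^+ 3 * e by apply: ler_pM => //; exact: ltW.
  by lra.
pose u i := x' i / x i; pose v j := y' j / y j.
have u0 l : 0 < u l by exact: divr_gt0.
have v0 l : 0 < v l by exact: divr_gt0.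
have uE l : u l * x l = x' l by rewrite mulfVK ?gt_eqF.
have vE l : v l * y l = y' l by rewrite mulfVK ?gt_eqF.
(* Two factors serving the same prescribed sum [d] have quotient S / S' up to [k] either way, and
   this reference value is the same for all rows; so corrections in different rows differ by at most
   k^2. *)
have ratio (p p' S S' d : R) : 0 < p -> 0 < p' -> 0 < S -> 0 < S' ->
    p * (a * S) <= d <= p * (b * S) -> p' * (a * S') <= d <= p' * (b * S') ->
    k^-1 * (S / S') <= p' / p <= k * (S / S').
  move=> p0 p'0 S0 S'0 /andP[q1 q2] /andP[q3 q4].
  rewrite /k invf_div; apply/andP; split.
    rewrite ler_pdivlMr// [leLHS](_ : _ = p * (a * S) / (b * S')); last first.
      by field; rewrite !gt_eqF.
    by rewrite ler_pdivrMr ?mulr_gt0//; exact: le_trans q1 q4.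
  rewrite ler_pdivrMr// [leRHS](_ : _ = p * (b * S) / (a * S')); last first.
    by field; rewrite !gt_eqF.
  by rewrite ler_pdivlMr ?mulr_gt0//; exact: le_trans q3 q2.
have kk (p p' z : R) : 0 < z -> p <= k * z -> k^-1 * z <= p' -> p <= k ^+ 2 * p'.
  move=> z0 pz zp'; apply: (le_trans pz).
  have : k ^+ 2 * (k^-1 * z) <= k ^+ 2 * p' by rewrite ler_wpM2l// exprn_ge0// (le_trans ler01).
  apply: le_trans.
  by rewrite expr2 mulrA mulfK// gt_eqF// (lt_le_trans ltr01).
have uV0 l m : u l <= k ^+ 2 * u m.
  have /andP[_ g1] := ratio _ _ _ _ _ (x0 l) (x'0 l) Y0 Y'0 (h1 l) (h1' l).
  have /andP[g2 _] := ratio _ _ _ _ _ (x0 m) (x'0 m) Y0 Y'0 (h1 m) (h1' m).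
  by apply: kk g1 g2; exact: divr_gt0.
have vV0 l m : v l <= k ^+ 2 * v m.
  have /andP[_ g1] := ratio _ _ _ _ _ (y0 l) (y'0 l) X0 X'0 (h2 l) (h2' l).
  have /andP[g2 _] := ratio _ _ _ _ _ (y0 m) (y'0 m) X0 X'0 (h2 m) (h2' m).
  by apply: kk g1 g2; exact: divr_gt0.
have mid (p W S d : R) : 0 < p -> p * W = d -> `|p * S - d| <= e * d ->
    (1 - e) * W <= S <= (1 + e) * W.
  move=> p0 pW; rewrite ler_norml => /andP[g1 g2].
  by apply/andP; split; rewrite -(ler_pM2l p0) mulrCA pW; lra.
have Hr' l : (1 - e) * (u l * \sum_j B l j * y j * v j) <= \sum_j B l j * y j
             <= (1 + e) * (u l * \sum_j B l j * y j * v j).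
  have E1 : x l * (u l * \sum_j B l j * y j * v j) = r l.
    rewrite mulrA [x l * _]mulrC uE -xr' mulr_sumr; apply: eq_bigr => m _.
    by rewrite -vE; ring.
  have E2 : x l * (\sum_j B l j * y j) = r l + x l * \sum_j (B l j - A l j) * y j.
    rewrite -(xr l) !mulr_sumr -big_split/=; apply: eq_bigr => m _; ring.
  by apply: (mid _ _ _ _ (x0 l) E1); rewrite E2 addrAC subrr add0r; exact: Hr.
have Hc' l : (1 - e) * (v l * \sum_i B i l * x i * u i) <= \sum_i B i l * x i
             <= (1 + e) * (v l * \sum_i B i l * x i * u i).
  have E1 : y l * (v l * \sum_i B i l * x i * u i) = c l.
    rewrite mulrA [y l * _]mulrC vE -yc' mulr_sumr; apply: eq_bigr => m _.
    by rewrite -uE; ring.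
  have E2 : y l * (\sum_i B i l * x i) = c l + y l * \sum_i (B i l - A i l) * x i.
    rewrite -(yc l) !mulr_sumr -big_split/=; apply: eq_bigr => m _; ring.
  by apply: (mid _ _ _ _ (y0 l) E1); rewrite E2 addrAC subrr add0r; exact: Hc.
have uv : `|u i * v j - 1| <= (8 * k ^+ 2 / (a / b) + 2 * k ^+ 2) * e.
  exact: (approximate_scaling_stability _ _ _ Bab x0 y0 u0 v0 uV0 vV0 e0 e2 Hr' Hc').
rewrite -uE -vE [X in `|X|](_ : _ = (u i * v j - 1) * (x i * y j)); last by ring.
rewrite normrM (gtr0_norm (mulr_gt0 (x0 i) (y0 j))).
apply: (@le_trans _ _ (10 * k ^+ 3 * e * (b / a ^+ 2 * q))); last first.
  by rewrite le_eqVlt; apply/orP; left; apply/eqP; ring.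
apply: ler_pM => //; first by rewrite ltW// mulr_gt0.
apply: (le_trans uv); rewrite ler_wpM2r//.
have -> : 8 * k ^+ 2 / (a / b) = 8 * k ^+ 3 by rewrite /k; field; rewrite !gt_eqF.
have : k ^+ 2 <= k ^+ 3 by exact: ler_weXn2l.
by lra.
Qed.

End ScalingStability.

(** * Operator norm and rounding to a grid *)

Section OperatorNorm.
Context (R : realType).

Lemma sqr_sum_le1_norm_le1 (J : finType) (v : J -> R) :
  \sum_j v j ^+ 2 <= 1 -> forall j, `|v j| <= 1.
Proof.
move=> v1 j; rewrite -(@ler_sqr _ _ 1) ?nnegrE// expr1n real_normK ?num_real//.
by apply: le_trans v1; rewrite (bigD1 j)//= lerDl sumr_ge0// => k _; exact: sqr_ge0.
Qed.

(** Cauchy-Schwarz in the form 2 l |v_j| <= l^2 v_j^2 + 1 with l = sqrt q, summed over at most q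
    indices. *)
Lemma sum_norm_le_sqrt (J : finType) (v : J -> R) (q : nat) :
  (0 < q)%N -> (#|J| <= q)%N -> \sum_j v j ^+ 2 <= 1 ->
  \sum_j `|v j| <= Num.sqrt q%:R.
Proof.
move=> q0 Jq v1; set l : R := Num.sqrt q%:R.
have l0 : 0 < l by rewrite sqrtr_gt0 ltr0n.
have lE : l ^+ 2 = q%:R by rewrite sqr_sqrtr.
rewrite -(ler_pM2l (mulr_gt0 (@ltr0Sn R 1) l0)) mulr_sumr.
apply: (@le_trans _ _ (\sum_j (l ^+ 2 * v j ^+ 2 + 1))).
  apply: ler_sum => j _; have := sqr_ge0 (l * `|v j| - 1).
  by rewrite sqrrB1 exprMn real_normK ?num_real//; lra.
rewrite big_split/= -mulr_sumr sumr_const lE -mulrA -expr2 lE.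
have : #|J|%:R <= q%:R :> R by rewrite ler_nat.
have : q%:R * (\sum_j v j ^+ 2) <= q%:R * 1 by rewrite ler_wpM2l.
by rewrite mulr_natl; lra.
Qed.

(** The test vector w = E v / |E v| turns the bilinear form into |E v|. *)
Lemma op_norm_le m n (E : 'M[R]_(m, n)) (t : R) : 0 <= t ->
  (forall (w : 'I_m -> R) (v : 'I_n -> R),
     \sum_i w i ^+ 2 <= 1 -> \sum_j v j ^+ 2 <= 1 ->
     \sum_i \sum_j w i * E i j * v j <= t) ->
  op_norm E <= t.
Proof.
move=> t0 H; rewrite /op_norm; apply: ge_sup.
  exists (l2norm (E *m 0)), 0 => //=.
  by rewrite /l2norm big1 ?sqrtr0// => i _; rewrite mxE expr0n.
move=> _ [v /= v1 <-].
have v1' : \sum_j v j 0 ^+ 2 <= 1.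
  have S0 : 0 <= \sum_j v j 0 ^+ 2 by apply: sumr_ge0 => j _; exact: sqr_ge0.
  by move: v1; rewrite /l2norm -(@ler_sqr _ _ 1) ?nnegrE ?sqrtr_ge0// sqr_sqrtr// expr1n.
set N := l2norm (E *m v).
have S0 : 0 <= \sum_i (E *m v) i 0 ^+ 2 by apply: sumr_ge0 => j _; exact: sqr_ge0.
have N2 : N ^+ 2 = \sum_i (E *m v) i 0 ^+ 2 by rewrite sqr_sqrtr.
have [N0|N0] := leP N 0; first exact: le_trans t0.
have := H (fun i => (E *m v) i 0 / N) (fun j => v j 0) _ v1'.
have -> : \sum_i \sum_j (E *m v) i 0 / N * E i j * v j 0 = N.
  rewrite (eq_bigr (fun i => (E *m v) i 0 ^+ 2 / N)); last first.
    move=> i _; under eq_bigr => j _ do rewrite -mulrA.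
    by rewrite -mulr_sumr expr2 [in RHS]mulrAC; congr (_ * _); rewrite mxE.
  by rewrite -mulr_suml -N2 expr2 mulfK// gt_eqF.
apply; under eq_bigr => i _ do rewrite exprMn.
by rewrite -mulr_suml -N2 exprVn mulfV// expf_neq0// gt_eqF.
Qed.

(** Coordinates (-1)^s p / q with 0 <= p <= q, coded by finite functions so that the union bound can
    count (2 (q + 1))^#|I| codes. *)
Definition grid_point (I : finType) (q : nat) (g : {ffun I -> bool * 'I_q.+1})
  (i : I) : R := (-1) ^+ (g i).1 * ((g i).2%:R / q%:R).

(** Each coordinate is rounded towards zero, which keeps the vector in the unit ball; the numerator
    is at most [q] because coordinates in the unit ball are at most 1 in absolute value. *)
Lemma grid_approximation (I : finType) (q : nat) (w : I -> R) :
  (0 < q)%N -> \sum_i w i ^+ 2 <= 1 ->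
  exists g : {ffun I -> bool * 'I_q.+1}, forall i,
    `|w i - grid_point g i| <= q%:R^-1 /\ `|grid_point g i| <= `|w i|.
Proof.
move=> q0 w1; have q0' : 0 < q%:R :> R by rewrite ltr0n.
exists [ffun i => (w i < 0, inord (Num.truncn (q%:R * `|w i|)))] => i.
have qw0 : 0 <= q%:R * `|w i| by rewrite mulr_ge0.
have /andP[t1 t2] := truncn_itv qw0.
have tq : (Num.truncn (q%:R * `|w i|) < q.+1)%N.
  rewrite ltnS -(ler_nat R); apply: (le_trans t1).
  by rewrite ler_piMr ?ler0n// (sqr_sum_le1_norm_le1 w1).
rewrite /grid_point ffunE /= inordK//; set p := Num.truncn _ in t1 t2 *.
have hp : `|w i| - q%:R^-1 <= p%:R / q%:R <= `|w i|.
  rewrite ler_pdivrMr// ler_pdivlMr// mulrBl mulVf ?gt_eqF// lerBlDr.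
  by rewrite ![`|w i| * _]mulrC t1 natr1 ltW.
have p0 : 0 <= p%:R / q%:R :> R by rewrite divr_ge0.
rewrite normrM normr_sign mul1r ger0_norm//; split; last by case/andP: hp.
have -> : w i - (-1) ^+ (w i < 0)%R * (p%:R / q%:R) =
    (-1) ^+ (w i < 0)%R * (`|w i| - p%:R / q%:R).
  by rewrite mulrBr -numEsign.
by rewrite normrM normr_sign mul1r ger0_norm ?subr_ge0; lra.
Qed.

(** The vectors are rounded one after the other. A rounding error, at most 1 / q in at most q
    coordinates, has l1 norm at most 1; the other vector has l1 norm at most sqrt q. Each
    replacement thus costs D sqrt q. *)
Lemma bilinear_le_grid (I J : finType) (E : I -> J -> R) (D tau : R) (q : nat)
    (w : I -> R) (v : J -> R) :
  (0 < q)%N -> (#|I| <= q)%N -> (#|J| <= q)%N -> 0 <= D ->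
  (forall i j, `|E i j| <= D) ->
  (forall (g : {ffun I -> bool * 'I_q.+1}) (h : {ffun J -> bool * 'I_q.+1}),
     \sum_i grid_point g i ^+ 2 <= 1 -> \sum_j grid_point h j ^+ 2 <= 1 ->
     \sum_i \sum_j grid_point g i * E i j * grid_point h j <= tau) ->
  \sum_i w i ^+ 2 <= 1 -> \sum_j v j ^+ 2 <= 1 ->
  \sum_i \sum_j w i * E i j * v j <= tau + 2 * D * Num.sqrt q%:R.
Proof.
move=> q0 Iq Jq D0 ED H w1 v1.
have q0' : 0 < q%:R :> R by rewrite ltr0n.
have [g Hg] := grid_approximation q0 w1; have [h Hh] := grid_approximation q0 v1.
have grid1 (K : finType) (f f' : K -> R) :
    (forall k, `|f' k| <= `|f k|) -> \sum_k f k ^+ 2 <= 1 -> \sum_k f' k ^+ 2 <= 1.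
  move=> ff; apply: le_trans; apply: ler_sum => k _.
  by rewrite -(real_normK (num_real (f k))) -(real_normK (num_real (f' k))) ler_sqr ?nnegrE.
have g1 : \sum_i grid_point g i ^+ 2 <= 1 by apply: grid1 w1 => k; case: (Hg k).
have h1 : \sum_j grid_point h j ^+ 2 <= 1 by apply: grid1 v1 => k; case: (Hh k).
have bil (f : I -> R) (f' : J -> R) :
    \sum_i \sum_j f i * E i j * f' j <= D * ((\sum_i `|f i|) * (\sum_j `|f' j|)).
  rewrite mulr_suml mulr_sumr; apply: ler_sum => i _.
  rewrite mulr_sumr mulr_sumr; apply: ler_sum => j _.
  apply: (le_trans (ler_norm _)); rewrite !normrM.
  by rewrite mulrAC [leRHS]mulrC ler_wpM2l ?mulr_ge0.
have err (K : finType) (f f' : K -> R) : (#|K| <= q)%N ->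
    (forall k, `|f k - f' k| <= q%:R^-1) -> \sum_k `|f k - f' k| <= 1.
  move=> Kq ff; apply: (@le_trans _ _ (\sum_(k : K) q%:R^-1)).
    by apply: ler_sum => k _.
  by rewrite sumr_const -[_ *+ #|_|]mulr_natl ler_pdivrMr// mul1r ler_nat.
have -> : \sum_i \sum_j w i * E i j * v j =
    (\sum_i \sum_j grid_point g i * E i j * grid_point h j) +
    (\sum_i \sum_j (w i - grid_point g i) * E i j * v j +
     \sum_i \sum_j grid_point g i * E i j * (v j - grid_point h j)).
  rewrite -!big_split/=; apply: eq_bigr => i _; rewrite -!big_split/=.
  by apply: eq_bigr => j _; ring.
apply: lerD; first exact: H.
rewrite [leRHS](_ : _ = D * Num.sqrt q%:R + D * Num.sqrt q%:R); last by ring.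
apply: lerD; apply: (le_trans (bil _ _)); rewrite ler_wpM2l//.
  rewrite -[leRHS]mul1r; apply: ler_pM; rewrite ?sumr_ge0//.
  - by apply: err => // k; case: (Hg k).
  - exact: sum_norm_le_sqrt.
rewrite -[leRHS]mulr1; apply: ler_pM; rewrite ?sumr_ge0//.
- exact: sum_norm_le_sqrt.
- by apply: err => // k; case: (Hh k).
Qed.

End OperatorNorm.

(** * Concentration *)

Section UnionBound.
Context d (T : measurableType d) (R : realType) (P : probability T R).

Lemma finite_union_bound (K : finType) (F : K -> set T) (p : R) :
  (forall k, measurable (F k)) -> (forall k, (P (F k) <= p%:E)%E) ->
  measurable [set w | exists k, F k w] /\
  (P [set w | exists k, F k w] <= (#|K|%:R * p)%:E)%E.
Proof.
move=> mF PF.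
have gen (s : seq K) : measurable [set w | exists2 k, k \in s & F k w] /\
    (P [set w | exists2 k, k \in s & F k w] <= ((size s)%:R * p)%:E)%E.
  elim: s => [|k s [IHm IHP]].
    have -> : [set w | exists2 k, k \in [::] & F k w] = set0.
      by apply/seteqP; split => w // -[].
    by rewrite measure0 mul0r.
  have -> : [set w | exists2 k', k' \in k :: s & F k' w] =
      F k `|` [set w | exists2 k', k' \in s & F k' w].
    apply/seteqP; split => w /=.
      by move=> [k']; rewrite inE => /orP[/eqP ->|?] ?; [left|right; exists k'].
    move=> [Fk|[k' k's ?]]; first by exists k => //; exact: mem_head.
    by exists k' => //; rewrite inE k's orbT.
  split; first exact: measurableU.
  apply: (le_trans (measureU2 _ (mF k) IHm)).
  by rewrite /= -natr1 mulrDl mul1r addrC EFinD leeD.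
have := gen (enum K); rewrite -cardE.
suff -> : [set w | exists2 k, k \in enum K & F k w] = [set w | exists k, F k w] by [].
apply/seteqP; split => w /=; first by move=> [k _ ?]; exists k.
by move=> [k ?]; exists k => //; rewrite mem_enum.
Qed.

Lemma hoeffding_union (I : finType) (X : I -> {RV P >-> R}) (a b : R)
    (mu : I -> R) (tau : R) (K : finType) (t : K -> I -> R) :
  0 < a -> a <= b -> mutually_independent X ->
  (forall i, {ae P, forall w, a <= X i w <= b}) ->
  (forall i, ((mu i)%:E = 'E_P[X i])%E) ->
  (forall k, \sum_i t k i ^+ 2 <= 1) -> 0 <= tau ->
  let bad := [set w | exists k, tau < \sum_i t k i * (X i w - mu i)] in
  measurable bad /\
  (P bad <= (#|K|%:R * expR (- (tau ^+ 2 / (12 * b ^+ 2))))%:E)%E.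
Proof.
move=> a0 ab indep Xab Emu t1 tau0; apply: finite_union_bound => k; last first.
  exact: (hoeffding_tail a0 ab indep Xab Emu).
rewrite -[X in measurable X]setTI.
apply: (@measurable_fun_ltr _ _ _ _ (cst tau)) => //.
apply: measurable_sum => i; apply: measurable_funM => //.
by apply: measurable_funB => //; exact: measurable_funPT.
Qed.

End UnionBound.

(** * Concentration of row sums, column sums and grid bilinear forms *)

Section Concentration.
Context d (T : measurableType d) (R : realType) (P : probability T R).

(** The union bound is applied to the normalised vectors z k / |z k| and to their negatives, whence
    the factor 2. *)
Lemma hoeffding_simultaneous (I : finType) (X : I -> {RV P >-> R}) (a b : R)
    (mu : I -> R) (tau : R) (K : finType) (z : K -> I -> R) :
  0 < a -> a <= b -> mutually_independent X ->
  (forall i, {ae P, forall w, a <= X i w <= b}) ->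
  (forall i, ((mu i)%:E = 'E_P[X i])%E) -> 0 <= tau ->
  exists bad, [/\ measurable bad,
    (P bad <= (2 * #|K|%:R * expR (- (tau ^+ 2 / (12 * b ^+ 2))))%:E)%E &
    forall w, ~ bad w -> forall k,
      `|\sum_i z k i * (X i w - mu i)| <= tau * Num.sqrt (\sum_i z k i ^+ 2)].
Proof.
move=> a0 ab indep Xab Emu tau0.
pose N k : R := Num.sqrt (\sum_i z k i ^+ 2).
have S0 k : 0 <= \sum_i z k i ^+ 2 by apply: sumr_ge0 => i _; exact: sqr_ge0.
have N2 k : N k ^+ 2 = \sum_i z k i ^+ 2 by rewrite sqr_sqrtr.
(* Division by zero yields 0, so a vanishing [z k] gives the zero functional, which also meets the
   norm condition. *)
pose t (sk : bool * K) i : R := (-1) ^+ sk.1 * (z sk.2 i / N sk.2).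
have t1 sk : \sum_i t sk i ^+ 2 <= 1.
  under eq_bigr => i _ do rewrite /t exprMn sqrr_sign mul1r exprMn.
  rewrite -mulr_suml -N2 -exprMn; have [->|Nk] := eqVneq (N sk.2) 0.
    by rewrite mul0r expr0n.
  by rewrite divff// expr1n.
have [mbad Pbad] := hoeffding_union a0 ab indep Xab Emu t1 tau0.
exists [set w | exists k, tau < \sum_i t k i * (X i w - mu i)]; split => //.
  by rewrite card_prod card_bool natrM in Pbad.
move=> w nbad k; rewrite -/(N k).
have [Nk|Nk] := eqVneq (N k) 0.
  have z0 i : z k i = 0.
    have := N2 k; rewrite Nk expr0n => /esym/eqP.
    rewrite psumr_eq0 => [/allP/(_ i (mem_index_enum _))|j _]; last exact: sqr_ge0.
    by rewrite sqrf_eq0 => /eqP.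
  by rewrite Nk mulr0 big1 ?normr0// => i _; rewrite z0 mul0r.
have Nk0 : 0 < N k by rewrite lt_neqAle eq_sym Nk sqrtr_ge0.
have bnd (s : bool) : (-1) ^+ s * \sum_i z k i * (X i w - mu i) <= tau * N k.
  rewrite -ler_pdivrMr// leNgt; apply/negP => h; apply: nbad; exists (s, k).
  apply: (lt_le_trans h); rewrite mulr_sumr mulr_suml le_eqVlt; apply/orP; left.
  by apply/eqP; apply: eq_bigr => i _; rewrite /t /=; ring.
have := bnd false; have := bnd true; rewrite expr0 expr1 => h1 h2.
by rewrite ler_norml; apply/andP; split; lra.
Qed.

Lemma expR_Nmul_ln (q : nat) (k : nat) : (0 < q)%N ->
  expR (- (k%:R * ln (q%:R : R))) = (q%:R ^+ k)^-1.
Proof. by move=> q0; rewrite expRN expRM_natl lnK// posrE ltr0n. Qed.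

(** As [x] and [y] are deterministic, the row sums, column sums and grid forms are linear
    functionals of the independent entries. Up to a factor 2, a row or column test fails with
    probability q^(-7) and a grid form, whose threshold is larger by sqrt q, with q^(-7 q). There
    are at most 2 q tests of the first kind and q^(6 q) of the second, which leaves 4 / q + 2 /
    q. *)
Lemma matrix_concentration (I J : finType) (X : I * J -> {RV P >-> R})
    (a b : R) (mu : I * J -> R) (x : I -> R) (y : J -> R) (q : nat) :
  0 < a -> a <= b -> mutually_independent X ->
  (forall ij, {ae P, forall w, a <= X ij w <= b}) ->
  (forall ij, ((mu ij)%:E = 'E_P[X ij])%E) ->
  (2 <= q)%N -> (#|I| <= q)%N -> (#|J| <= q)%N ->
  let tau := b * Num.sqrt (84 * ln q%:R) in
  exists bad, [/\ measurable bad, (P bad <= (6 / q%:R)%:E)%E &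
    forall w, ~ bad w ->
      let E i j := X (i, j) w - mu (i, j) in
      [/\ forall i, `|\sum_j E i j * y j| <= tau * Num.sqrt (\sum_j y j ^+ 2),
          forall j, `|\sum_i E i j * x i| <= tau * Num.sqrt (\sum_i x i ^+ 2) &
          forall (g : {ffun I -> bool * 'I_q.+1}) (h : {ffun J -> bool * 'I_q.+1}),
            \sum_i grid_point R g i ^+ 2 <= 1 ->
            \sum_j grid_point R h j ^+ 2 <= 1 ->
            \sum_i \sum_j grid_point R g i * E i j * grid_point R h j
              <= tau * Num.sqrt q%:R]].
Proof.
move=> a0 ab indep Xab Emu q2 Iq Jq tau.
have b0 : 0 < b by exact: lt_le_trans ab.
have q1 : (0 < q)%N by exact: leq_trans q2.
have qR : 0 < q%:R :> R by rewrite ltr0n.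
have qR1 : 1 <= q%:R :> R by rewrite ler1n.
have L0 : 0 <= ln (q%:R : R) by exact: ln_ge0.
have tau0 : 0 <= tau by rewrite mulr_ge0 ?sqrtr_ge0// ltW.
(* The 84 in [tau] is 12 * 7, which produces the exponent 7. *)
have tauE : tau ^+ 2 / (12 * b ^+ 2) = 7%:R * ln (q%:R : R).
  by rewrite exprMn sqr_sqrtr ?mulr_ge0//; field; rewrite gt_eqF.
pose z1 (k : I + J) (ij : I * J) : R :=
  match k with inl i => (ij.1 == i)%:R * y ij.2 | inr j => (ij.2 == j)%:R * x ij.1 end.
pose z2 (gh : {ffun I -> bool * 'I_q.+1} * {ffun J -> bool * 'I_q.+1}) (ij : I * J) :=
  grid_point R gh.1 ij.1 * grid_point R gh.2 ij.2.
have [bad1 [mb1 Pb1 H1]] := hoeffding_simultaneous z1 a0 ab indep Xab Emu tau0.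
have tau20 : 0 <= tau * Num.sqrt q%:R by rewrite mulr_ge0 ?sqrtr_ge0.
have [bad2 [mb2 Pb2 H2]] := hoeffding_simultaneous z2 a0 ab indep Xab Emu tau20.
have sum_row (f : I * J -> R) (i : I) :
    \sum_ij (ij.1 == i)%:R * f ij = \sum_j f (i, j).
  rewrite (eq_bigr (fun ij => (ij.1 == i)%:R * f (ij.1, ij.2))); last by move=> [].
  rewrite -(pair_bigA _ (fun k j => (k == i)%:R * f (k, j)))/=.
  rewrite (bigD1 i)//= [X in _ + X]big1 ?addr0.
    by apply: eq_bigr => j _; rewrite eqxx mul1r.
  by move=> k /negPf ->; apply: big1 => j _; rewrite mul0r.
have sum_col (f : I * J -> R) (j : J) :
    \sum_ij (ij.2 == j)%:R * f ij = \sum_i f (i, j).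
  rewrite (eq_bigr (fun ij => (ij.2 == j)%:R * f (ij.1, ij.2))); last by move=> [].
  rewrite -(pair_bigA _ (fun i k => (k == j)%:R * f (i, k)))/=.
  apply: eq_bigr => i _; rewrite (bigD1 j)//= eqxx mul1r big1 ?addr0//.
  by move=> k /negPf ->; rewrite mul0r.
exists (bad1 `|` bad2); split.
- exact: measurableU.
- apply: (le_trans (measureU2 _ mb1 mb2)).
  have -> : 6 / q%:R = 4 / q%:R + 2 / q%:R :> R by field; rewrite gt_eqF.
  rewrite EFinD; apply: leeD.
    apply: (le_trans Pb1); rewrite lee_fin tauE expR_Nmul_ln// card_sum natrD.
    rewrite ler_pdivrMr ?exprn_gt0// mulrAC ler_pdivlMr//.
    have hI : #|I|%:R <= q%:R :> R by rewrite ler_nat.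
    have hJ : #|J|%:R <= q%:R :> R by rewrite ler_nat.
    apply: (@le_trans _ _ (4 * q%:R ^+ 2)); first by rewrite expr2; nra.
    by rewrite ler_pM2l//; exact: ler_weXn2l.
  apply: (le_trans Pb2); rewrite lee_fin.
  have -> : (tau * Num.sqrt q%:R) ^+ 2 / (12 * b ^+ 2) = (7 * q)%:R * ln (q%:R : R).
    by rewrite exprMn sqr_sqrtr// mulrAC tauE natrM; ring.
  rewrite expR_Nmul_ln// ler_pdivrMr ?exprn_gt0//.
  rewrite card_prod !card_ffun !card_prod card_bool card_ord -expnD.
  rewrite mulrAC -mulrA ler_pM2l// ler_pdivlMr// -natrX -natrM ler_nat mulnC.
  (* A coordinate code takes 2 (q + 1) values, at most q^3 since q >= 2. With at most 2 q
     coordinates the count is q^(6 q), and a further factor q stays below q^(7 q). *)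
  have h3 : (2 * q.+1 <= q ^ 3)%N by rewrite !expnS expn0; nia.
  apply: (@leq_trans (q * (q ^ 3) ^ (q + q))).
    rewrite leq_mul2l; apply/orP; right.
    apply: (@leq_trans ((2 * q.+1) ^ (q + q))); first by rewrite leq_pexp2l// leq_add.
    by rewrite leq_exp2r// addn_gt0 q1.
  rewrite -expnM -expnS leq_pexp2l//; lia.
move=> w nb E.
have nb1 : ~ bad1 w by move=> ?; apply: nb; left.
have nb2 : ~ bad2 w by move=> ?; apply: nb; right.
split.
- move=> i; have := H1 w nb1 (inl i); rewrite /z1.
  under eq_bigr => ij _ do rewrite -mulrA.
  rewrite sum_row /=.
  have -> : \sum_ij ((ij.1 == i)%:R * y ij.2) ^+ 2 = \sum_j y j ^+ 2.
    rewrite -(sum_row (fun ij => y ij.2 ^+ 2) i); apply: eq_bigr => ij _.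
    by rewrite exprMn; case: eqP => _; rewrite ?expr1n ?expr0n.
  by under eq_bigr => j _ do rewrite mulrC.
- move=> j; have := H1 w nb1 (inr j); rewrite /z1.
  under eq_bigr => ij _ do rewrite -mulrA.
  rewrite sum_col /=.
  have -> : \sum_ij ((ij.2 == j)%:R * x ij.1) ^+ 2 = \sum_i x i ^+ 2.
    rewrite -(sum_col (fun ij => x ij.1 ^+ 2) j); apply: eq_bigr => ij _.
    by rewrite exprMn; case: eqP => _; rewrite ?expr1n ?expr0n.
  by under eq_bigr => i _ do rewrite mulrC.
move=> g h g1 h1; have := H2 w nb2 (g, h); rewrite /z2 /=.
have -> : \sum_ij (grid_point R g ij.1 * grid_point R h ij.2) ^+ 2 =
    (\sum_i grid_point R g i ^+ 2) * (\sum_j grid_point R h j ^+ 2).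
  under eq_bigr => ij _ do rewrite exprMn.
  rewrite -(pair_bigA _ (fun i j => grid_point R g i ^+ 2 * grid_point R h j ^+ 2))/=.
  by rewrite mulr_suml; apply: eq_bigr => i _; rewrite mulr_sumr.
have -> : \sum_i \sum_j grid_point R g i * E i j * grid_point R h j =
    \sum_ij grid_point R g ij.1 * grid_point R h ij.2 * (X ij w - mu ij).
  by rewrite pair_bigA/=; apply: eq_bigr => -[i j] _ /=; rewrite /E; ring.
move=> /(le_trans (ler_norm _)) hh; apply: (le_trans hh).
rewrite ler_piMr// -[leRHS]sqrtr1 ler_sqrt//.
have := @sumr_ge0 R I (index_enum I) xpredT (fun i => grid_point R g i ^+ 2)
  (fun i _ => sqr_ge0 _).
have := @sumr_ge0 R J (index_enum J) xpredT (fun j => grid_point R h j ^+ 2)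
  (fun j _ => sqr_ge0 _).
by move=> hh0 gg0; rewrite mulr_ile1.
Qed.

End Concentration.

(** * Difference of the scaled matrices *)

Section Rho.
Context (R : realType).

Lemma entry_le_max n (v : 'cV[R]_n) (i : 'I_n) : v i 0 <= max_entry v.
Proof.
apply: ub_le_sup; last by exists i.
exists (\sum_j `|v j 0|) => _ [j _ <-].
apply: (le_trans (ler_norm _)); rewrite (bigD1 j)//= lerDl.
exact: sumr_ge0.
Qed.

Lemma min_le_entry n (v : 'cV[R]_n) (i : 'I_n) :
  positive_mx v -> min_entry v <= v i 0.
Proof.
move=> v0; apply: ge_inf; last by exists i.
by exists 0 => _ [j _ <-]; exact: ltW.
Qed.

Lemma min_entry_gt0 n (v : 'cV[R]_n) : (0 < n)%N ->
  positive_mx v -> 0 < min_entry v.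
Proof.
move=> n0 v0; pose i0 := [arg min_(k < Ordinal n0) v k 0]%O.
have vi0 k : v i0 0 <= v k 0 by rewrite /i0; case: arg_minP => // l _; apply.
apply: (lt_le_trans (v0 i0 0)); apply: lb_le_inf; first by exists (v i0 0), i0.
by move=> _ [j _ <-].
Qed.

Lemma l1norm_pos n (v : 'cV[R]_n) : positive_mx v -> l1norm v = \sum_i v i 0.
Proof. by move=> v0; apply: eq_bigr => i _; rewrite gtr0_norm. Qed.

Lemma l1norm_gt0 n (v : 'cV[R]_n) : (0 < n)%N -> positive_mx v -> 0 < l1norm v.
Proof.
move=> n0 v0; rewrite l1norm_pos// (bigD1 (Ordinal n0))//= ltr_pwDl//.
by apply: sumr_ge0 => i _; exact: ltW.
Qed.

Lemma l1norm_le_l2norm n (v : 'cV[R]_n) : (0 < n)%N ->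
  l1norm v <= l2norm v * Num.sqrt n%:R.
Proof.
move=> n0; have S0 : 0 <= \sum_i v i 0 ^+ 2 by apply: sumr_ge0 => i _; exact: sqr_ge0.
have N2 : l2norm v ^+ 2 = \sum_i v i 0 ^+ 2 by rewrite sqr_sqrtr.
have [N0|N0] := eqVneq (l2norm v) 0.
  rewrite N0 mul0r /l1norm big1// => i _.
  move: N2; rewrite N0 expr0n => /esym/eqP.
  rewrite psumr_eq0 => [/allP/(_ i (mem_index_enum _))|j _]; last exact: sqr_ge0.
  by rewrite sqrf_eq0 => /eqP ->; rewrite normr0.
have Npos : 0 < l2norm v by rewrite lt_neqAle eq_sym N0 sqrtr_ge0.
have := @sum_norm_le_sqrt R _ (fun i => v i 0 / l2norm v) n n0.
rewrite card_ord => /(_ (leqnn _)).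
under eq_bigr => i _ do rewrite exprMn exprVn.
rewrite -mulr_suml -N2 divff ?expf_neq0// => /(_ (lexx _)).
under eq_bigr => i _ do rewrite normrM normfV (gtr0_norm Npos).
by rewrite -mulr_suml ler_pdivrMr// mulrC.
Qed.

(** The least entry of [r] is at most the mean entry. This permits inserting [rho2] into the final
    bound. *)
Lemma rho2_ge1 m n (r : 'cV[R]_m) (c : 'cV[R]_n) : (0 < m)%N ->
  positive_mx r -> 1 <= rho2 r c.
Proof.
move=> m0 r0; rewrite /rho2 le_max; apply/orP; left.
rewrite ler_pdivlMr ?mulr_gt0 ?ltr0n ?min_entry_gt0// mul1r l1norm_pos//.
rewrite mulr_natl -[X in _ *+ X]card_ord -sumr_const.
by apply: ler_sum => i _; exact: min_le_entry.
Qed.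

(** By Cauchy-Schwarz for [r] and for [c], [rho1] is at least 1 / sqrt m and 1 / sqrt n. The
    estimate absorbs the factor sqrt (max (m, n)) in the norm of the noise matrix. *)
Lemma sqrt_max_le_rho1 m n (r : 'cV[R]_m) (c : 'cV[R]_n) : (0 < m)%N ->
  (0 < n)%N -> positive_mx r -> l1norm r = l1norm c ->
  Num.sqrt (maxn m n)%:R <= rho1 r c * (Num.sqrt m%:R * Num.sqrt n%:R).
Proof.
move=> m0 n0 r0 rc.
have s0 := l1norm_gt0 m0 r0.
have hm : 1 <= rho1 r c * Num.sqrt m%:R.
  apply: (@le_trans _ _ (l2norm r / l1norm r * Num.sqrt m%:R)).
    by rewrite mulrAC ler_pdivlMr// mul1r l1norm_le_l2norm.
  by rewrite ler_wpM2r ?sqrtr_ge0// le_max lexx.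
have hn : 1 <= rho1 r c * Num.sqrt n%:R.
  apply: (@le_trans _ _ (l2norm c / l1norm r * Num.sqrt n%:R)).
    by rewrite mulrAC ler_pdivlMr// mul1r rc l1norm_le_l2norm.
  by rewrite ler_wpM2r ?sqrtr_ge0// le_max lexx orbT.
case: (leqP m n) => _.
  by rewrite mulrA ler_peMl ?sqrtr_ge0.
by rewrite mulrCA mulrC ler_peMl ?sqrtr_ge0// mulrC.
Qed.

End Rho.

(** * From deviation bounds to the operator norm *)

Section DifferenceBound.
Context (R : realType).

(** Used with p = x_i, z = y, d = r_i, f = c, and with rows and columns exchanged: the deviation tau
    x_i |y|_2 of a row sum becomes a multiple of tau r_i |c|_2 / s, that is, of relative size tau
    [rho1]. *)
Lemma scaled_l2_bound (J : finType) (a b p S S' s d : R) (z f : J -> R) :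
  0 < a -> 0 < S -> 0 < S' -> 0 < s -> 0 <= p -> 0 <= b ->
  p * (a * S) <= d -> (forall j, 0 <= z j) -> (forall j, z j * (a * S') <= f j) ->
  s <= b * S' * S ->
  p * Num.sqrt (\sum_j z j ^+ 2) <= b / a ^+ 2 * (d * (Num.sqrt (\sum_j f j ^+ 2) / s)).
Proof.
move=> a0 S0 S'0 s0 p0 b0 pd z0 zf sb.
have aS'0 : 0 < a * S' by exact: mulr_gt0.
have h1 : Num.sqrt (\sum_j z j ^+ 2) * (a * S') <= Num.sqrt (\sum_j f j ^+ 2).
  have -> : a * S' = Num.sqrt ((a * S') ^+ 2) by rewrite sqrtr_sqr gtr0_norm.
  rewrite -sqrtrM; last by apply: sumr_ge0 => j _; exact: sqr_ge0.
  rewrite ler_wsqrtr// mulr_suml; apply: ler_sum => j _.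
  have zS0 : 0 <= z j * (a * S') by rewrite mulr_ge0// ltW.
  by rewrite -exprMn ler_sqr ?nnegrE// (le_trans zS0).
set Z := Num.sqrt _ in h1 *; set F := Num.sqrt _ in h1 *.
have Z0 : 0 <= Z by exact: sqrtr_ge0.
have h2 : (p * (a * S)) * (Z * (a * S')) <= d * F.
  by apply: ler_pM => //; apply: mulr_ge0 => //; apply: ltW => //; exact: mulr_gt0.
rewrite [leRHS](_ : _ = b * (d * F) / (a ^+ 2 * s)); last first.
  by field; rewrite !gt_eqF.
rewrite ler_pdivlMr ?mulr_gt0 ?exprn_gt0//.
apply: le_trans (ler_wpM2l b0 h2).
apply: (@le_trans _ _ (p * Z * (a ^+ 2 * (b * S' * S)))).
  by rewrite ler_wpM2l ?mulr_ge0// ler_pM2l ?exprn_gt0.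
by rewrite le_eqVlt; apply/orP; left; apply/eqP; ring.
Qed.

(** The two summands of the constant belong to the two parts of the difference: the change of the
    scaling factors, and the noise B - A between the fixed factors [x] and [y]. *)
Lemma scaled_difference_bound m n (A B : 'M[R]_(m, n)) (r : 'cV[R]_m)
    (c : 'cV[R]_n) (a b tau : R) (x x' : 'I_m -> R) (y y' : 'I_n -> R) :
  (0 < m)%N -> (0 < n)%N -> 0 < a ->
  positive_mx r -> positive_mx c -> l1norm r = l1norm c ->
  (forall i j, a <= A i j <= b) -> (forall i j, a <= B i j <= b) ->
  scales_fun (fun i => r i 0) (fun j => c j 0) A x y ->
  scales_fun (fun i => r i 0) (fun j => c j 0) B x' y' ->
  0 <= tau -> let E i j := B i j - A i j in let q := maxn m n in
  (forall i, `|\sum_j E i j * y j| <= tau * Num.sqrt (\sum_j y j ^+ 2)) ->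
  (forall j, `|\sum_i E i j * x i| <= tau * Num.sqrt (\sum_i x i ^+ 2)) ->
  (forall (g : {ffun 'I_m -> bool * 'I_q.+1}) (h : {ffun 'I_n -> bool * 'I_q.+1}),
     \sum_i grid_point R g i ^+ 2 <= 1 -> \sum_j grid_point R h j ^+ 2 <= 1 ->
     \sum_i \sum_j grid_point R g i * E i j * grid_point R h j
       <= tau * Num.sqrt q%:R) ->
  op_norm (\matrix_(i, j) (x' i * B i j * y' j) - \matrix_(i, j) (x i * A i j * y j))
    <= (10 * (b / a) ^+ 3 * (b / a ^+ 2) * (tau * (b / a ^+ 2)) * b
        + b / a ^+ 2 * (tau + 2 * b)) * (rho1 r c * rho3 r c).
Proof.
move=> m0 n0 a0 r0 c0 rc Aab Bab sA sB tau0 E q Hrow Hcol Hgrid.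
have [x0 y0 xr yc] := sA; have [x'0 y'0 xr' yc'] := sB.
have [h1 h2 h3] := scale_bounds Aab sA.
pose i0 := Ordinal m0; pose j0 := Ordinal n0.
have ab : a <= b by case/andP: (Aab i0 j0) => p1 p2; exact: le_trans p1 p2.
have b0 : 0 < b := lt_le_trans a0 ab.
set s := l1norm r in rc.
have sE : s = \sum_i r i 0 by exact: l1norm_pos.
have s0 : 0 < s by exact: l1norm_gt0.
rewrite -sE in h3.
have X0 : 0 < \sum_i x i.
  by rewrite (bigD1 i0)//= ltr_pwDl//; apply: sumr_ge0 => k _; exact: ltW.
have Y0 : 0 < \sum_j y j.
  by rewrite (bigD1 j0)//= ltr_pwDl//; apply: sumr_ge0 => k _; exact: ltW.
have C0 : 0 <= b / a ^+ 2 by rewrite divr_ge0 ?exprn_ge0// ltW.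
have rho1r : l2norm r / s <= rho1 r c by rewrite le_max lexx.
have rho1c : l2norm c / s <= rho1 r c by rewrite le_max lexx orbT.
have rho10 : 0 <= rho1 r c.
  by apply: le_trans rho1r; apply: divr_ge0; [exact: sqrtr_ge0 | exact: ltW].
pose e := tau * (b / a ^+ 2) * rho1 r c.
have e0 : 0 <= e by rewrite mulr_ge0// mulr_ge0.
have rowe i : `|x i * \sum_j (B i j - A i j) * y j| <= e * r i 0.
  rewrite normrM (gtr0_norm (x0 i)).
  apply: (le_trans (ler_wpM2l (ltW (x0 i)) (Hrow i))).
  rewrite mulrCA [leRHS](_ : _ = tau * (b / a ^+ 2 * (r i 0 * rho1 r c))); last first.
    by rewrite /e; ring.
  rewrite ler_wpM2l//.
  have /andP[p1 _] := h1 i.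
  apply: le_trans (scaled_l2_bound a0 Y0 X0 s0 (ltW (x0 i)) (ltW b0) p1
    (fun j => ltW (y0 j)) (fun j => proj1 (andP (h2 j))) h3) _.
  by rewrite ler_wpM2l// ler_wpM2l// ltW.
have cole j : `|y j * \sum_i (B i j - A i j) * x i| <= e * c j 0.
  rewrite normrM (gtr0_norm (y0 j)).
  apply: (le_trans (ler_wpM2l (ltW (y0 j)) (Hcol j))).
  rewrite mulrCA [leRHS](_ : _ = tau * (b / a ^+ 2 * (c j 0 * rho1 r c))); last first.
    by rewrite /e; ring.
  rewrite ler_wpM2l//.
  have /andP[p1 _] := h2 j.
  rewrite mulrAC in h3.
  apply: le_trans (scaled_l2_bound a0 X0 Y0 s0 (ltW (y0 j)) (ltW b0) p1
    (fun i => ltW (x0 i)) (fun i => proj1 (andP (h1 i))) h3) _.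
  by rewrite ler_wpM2l// ler_wpM2l// ltW.
have stab i j := scaling_stability a0 i j Aab Bab sA sB e0 rowe cole.

set rM := max_entry r; set cM := max_entry c.
have rM0 : 0 < rM by exact: lt_le_trans (r0 i0 0) (entry_le_max _ _).
have cM0 : 0 < cM by exact: lt_le_trans (c0 j0 0) (entry_le_max _ _).
have rho3E : rho3 r c = rM * cM / s * (Num.sqrt m%:R * Num.sqrt n%:R).
  by rewrite /rho3 -/rM -/cM -/s; ring.
have rcs0 : 0 <= rM * cM / s by rewrite divr_ge0 ?mulr_ge0 ?ltW.
set C := 10 * (b / a) ^+ 3 * (b / a ^+ 2) in stab *.
have C'0 : 0 <= C.
  by rewrite mulr_ge0// mulr_ge0// exprn_ge0// divr_ge0// ltW.
have rho30 : 0 <= rho3 r c by rewrite rho3E mulr_ge0// mulr_ge0 ?sqrtr_ge0.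
apply: op_norm_le => [|w v w1 v1].
  have b2 : 0 <= 2 * b by rewrite mulr_ge0// ltW.
  have tC : 0 <= C * (tau * (b / a ^+ 2)) by rewrite mulr_ge0// mulr_ge0.
  by rewrite mulr_ge0 ?(mulr_ge0 rho10 rho30)// addr_ge0// mulr_ge0// ?addr_ge0// ltW.
have -> : \sum_i \sum_j w i * (\matrix_(i, j) (x' i * B i j * y' j)
      - \matrix_(i, j) (x i * A i j * y j)) i j * v j =
    \sum_i \sum_j w i * ((x' i * y' j - x i * y j) * B i j) * v j +
    \sum_i \sum_j w i * (x i * E i j * y j) * v j.
  rewrite -big_split/=; apply: eq_bigr => i _; rewrite -big_split/=.
  by apply: eq_bigr => j _; rewrite !mxE /E; ring.
rewrite [leRHS]mulrDl; apply: lerD.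
  (* First part: an entrywise bound suffices, because the l1 norms of the test vectors are at most
     sqrt m and sqrt n, the square roots present in [rho3]. *)
  have Zb i j : `|(x' i * y' j - x i * y j) * B i j| <= C * e * b * (rM * cM / s).
    have /andP[Ba Bb] := Bab i j.
    rewrite normrM (ger0_norm (le_trans (ltW a0) Ba)).
    rewrite [leRHS](_ : _ = C * e * (rM * cM / s) * b); last by ring.
    apply: ler_pM => //; first exact: le_trans (ltW a0) Ba.
    apply: (le_trans (stab i j)); rewrite -sE (ler_wpM2l (mulr_ge0 C'0 e0))//.
    rewrite ler_pM2r ?invr_gt0//.
    by apply: ler_pM; rewrite ?(ltW (r0 i 0)) ?(ltW (c0 j 0)) ?entry_le_max.
  apply: (@le_trans _ _ (C * e * b * (rM * cM / s) *
      ((\sum_i `|w i|) * (\sum_j `|v j|)))).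
    rewrite mulr_suml mulr_sumr; apply: ler_sum => i _.
    rewrite mulr_sumr mulr_sumr; apply: ler_sum => j _.
    apply: (le_trans (ler_norm _)); rewrite !(normrM _ (v j)) normrM.
    by rewrite mulrAC [leRHS]mulrC ler_wpM2l// mulr_ge0.
  rewrite [leRHS](_ : _ = C * e * b * (rM * cM / s) * (Num.sqrt m%:R * Num.sqrt n%:R));
    last by rewrite rho3E /e; ring.
  rewrite (ler_wpM2l (mulr_ge0 (mulr_ge0 (mulr_ge0 C'0 e0) (ltW b0)) rcs0))//.
  by apply: ler_pM; rewrite ?sumr_ge0//; apply: sum_norm_le_sqrt; rewrite ?card_ord.
(* Second part: the ratios x / xm and y / ym are at most 1, so they are absorbed into the test
   vectors, leaving the bilinear form of the noise alone. *)
pose xm := rM / (a * \sum_j y j); pose ym := cM / (a * \sum_i x i).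
have xm0 : 0 < xm by rewrite divr_gt0 ?mulr_gt0.
have ym0 : 0 < ym by rewrite divr_gt0 ?mulr_gt0.
have xle i : x i <= xm.
  rewrite ler_pdivlMr ?mulr_gt0//; have /andP[p1 _] := h1 i.
  exact: le_trans p1 (entry_le_max _ _).
have yle j : y j <= ym.
  rewrite ler_pdivlMr ?mulr_gt0//; have /andP[p1 _] := h2 j.
  exact: le_trans p1 (entry_le_max _ _).
have shrink (K : finType) (f z : K -> R) (zm : R) : 0 < zm ->
    (forall k, 0 < z k) -> (forall k, z k <= zm) -> \sum_k f k ^+ 2 <= 1 ->
    \sum_k (f k * (z k / zm)) ^+ 2 <= 1.
  move=> zm0 z0 zle; apply: le_trans; apply: ler_sum => k _.
  rewrite exprMn ler_piMr ?sqr_ge0//; apply: exprn_ile1.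
    by rewrite divr_ge0// ltW.
  by rewrite ler_pdivrMr// mul1r.
have Eb i j : `|E i j| <= b.
  have /andP[p1 p2] := Bab i j; have /andP[p3 p4] := Aab i j.
  by rewrite ler_norml /E; apply/andP; split; lra.
have q0 : (0 < q)%N by rewrite leq_max m0.
have := @bilinear_le_grid R _ _ E b (tau * Num.sqrt q%:R) q _ _ q0 _ _ (ltW b0) Eb Hgrid
  (shrink _ _ _ _ xm0 x0 xle w1) (shrink _ _ _ _ ym0 y0 yle v1).
rewrite !card_ord leq_maxl leq_maxr => /(_ isT isT) hbil.
have -> : \sum_i \sum_j w i * (x i * E i j * y j) * v j =
    xm * ym * \sum_i \sum_j w i * (x i / xm) * E i j * (v j * (y j / ym)).
  rewrite mulr_sumr; apply: eq_bigr => i _; rewrite mulr_sumr; apply: eq_bigr => j _.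
  by field; rewrite !gt_eqF.
have xym : xm * ym <= b / a ^+ 2 * (rM * cM / s).
  rewrite [leLHS](_ : _ = rM * cM / (a ^+ 2 * ((\sum_i x i) * \sum_j y j))); last first.
    by rewrite /xm /ym; field; rewrite !gt_eqF.
  rewrite [leRHS](_ : _ = rM * cM * b / (a ^+ 2 * s)); last first.
    by field; rewrite !gt_eqF.
  rewrite ler_pdivrMr ?mulr_gt0 ?exprn_gt0// mulrAC ler_pdivlMr ?mulr_gt0 ?exprn_gt0//.
  rewrite [leRHS](_ : _ = rM * cM * (a ^+ 2 * (b * (\sum_i x i) * \sum_j y j))); last by ring.
  by rewrite ler_pM2l ?mulr_gt0// ler_pM2l ?exprn_gt0.
apply: (@le_trans _ _ (b / a ^+ 2 * (rM * cM / s) * ((tau + 2 * b) * Num.sqrt q%:R))).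
  apply: (@le_trans _ _ (xm * ym * ((tau + 2 * b) * Num.sqrt q%:R))).
    rewrite (ler_wpM2l (mulr_ge0 (ltW xm0) (ltW ym0)))//.
    by apply: (le_trans hbil); rewrite [leRHS]mulrDl.
  by rewrite ler_wpM2r// mulr_ge0// addr_ge0// mulr_ge0// ltW.
have hq := sqrt_max_le_rho1 m0 n0 r0 rc; rewrite -/q in hq.
rewrite rho3E.
rewrite [leLHS](_ : _ = b / a ^+ 2 * (tau + 2 * b) * (rM * cM / s) * Num.sqrt q%:R); last by ring.
rewrite [leRHS](_ : _ = b / a ^+ 2 * (tau + 2 * b) * (rM * cM / s) *
  (rho1 r c * (Num.sqrt m%:R * Num.sqrt n%:R))); last by ring.
rewrite ler_wpM2l// mulr_ge0// mulr_ge0// addr_ge0// mulr_ge0// ltW//.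
Qed.

End DifferenceBound.

(** * Measurability *)

Section Continuity.
Context (R : realFieldType) (I J : finType) (r : I -> R) (c : J -> R).

(** Near a fixed positive [A] all entries lie in one interval [a, b], so the stability estimate
    applies with constants fixed in advance. *)
Lemma scaling_locally_lipschitz (A : I -> J -> R) (x : I -> R) (y : J -> R) :
  (forall i j, 0 < A i j) -> (forall i, 0 < r i) -> (forall j, 0 < c j) ->
  scales_fun r c A x y ->
  exists G d0 : R, [/\ 0 <= G, 0 < d0 &
    forall (d : R) B x' y', 0 <= d -> d <= d0 -> (forall i j, `|B i j - A i j| <= d) ->
      scales_fun r c B x' y' ->
      forall i j, `|x' i * B i j * y' j - x i * A i j * y j| <= d * G].
Proof.
move=> A0 r0 c0 sA; have [x0 y0 xr yc] := sA.
(* [S] is at least every 1 / A_ij, hence A_ij >= 2 a, and a perturbation by d <= a leaves entries at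
   least [a]. The leading 1 gives a <= 1, and the one in [b] leaves room for that perturbation
   above. *)
pose S := 1 + \sum_i \sum_j (A i j)^-1; pose a := (2 * S)^-1.
pose b := 1 + \sum_i \sum_j A i j.
have le_sum2 (f : I -> J -> R) i j : (forall i j, 0 < f i j) ->
    f i j <= \sum_i \sum_j f i j.
  move=> f0; rewrite (bigD1 i)//= (bigD1 j)//= -addrA lerDl addr_ge0//.
    by apply: sumr_ge0 => k _; exact: ltW.
  by apply: sumr_ge0 => k _; apply: sumr_ge0 => l _; exact: ltW.
have sum2_ge0 (f : I -> J -> R) : (forall i j, 0 <= f i j) ->
    0 <= \sum_i \sum_j f i j.
  by move=> f0; apply: sumr_ge0 => k _; apply: sumr_ge0 => l _.
have iA0 i j : 0 < (A i j)^-1 by rewrite invr_gt0.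
have S1 : 1 <= S by rewrite lerDl sum2_ge0// => i j; exact: ltW.
have S0 : 0 < S by exact: lt_le_trans S1.
have a0 : 0 < a by rewrite invr_gt0 mulr_gt0.
have a1 : a <= 1 by rewrite invf_le1 ?mulr_gt0//; lra.
have aA i j : 2 * a <= A i j.
  rewrite /a invfM mulrA divff ?mul1r// -[leRHS]invrK lef_pV2 ?posrE//.
  by rewrite (le_trans (le_sum2 _ i j iA0))// lerDr.
have Ab i j : A i j + 1 <= b by rewrite addrC lerD2l le_sum2.
pose X := \sum_i x i; pose Y := \sum_j y j.
have X0 : 0 <= X by apply: sumr_ge0 => k _; exact: ltW.
have Y0 : 0 <= Y by apply: sumr_ge0 => k _; exact: ltW.
(* [K] turns an entrywise error [d] into an error d K relative to every prescribed row and column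
   sum. *)
pose K := \sum_i x i * Y / r i + \sum_j y j * X / c j.
have xY i : 0 <= x i * Y / r i.
  by rewrite divr_ge0 ?(ltW (r0 i))// mulr_ge0// ltW.
have yX j : 0 <= y j * X / c j.
  by rewrite divr_ge0 ?(ltW (c0 j))// mulr_ge0// ltW.
have Kr i : x i * Y <= K * r i.
  rewrite -ler_pdivrMr// /K (bigD1 i)//= -addrA lerDl addr_ge0 ?sumr_ge0//.
have Kc j : y j * X <= K * c j.
  rewrite -ler_pdivrMr// /K [X in _ + X](bigD1 j)//= addrCA lerDl addr_ge0 ?sumr_ge0//.
have K0 : 0 <= K by rewrite addr_ge0 ?sumr_ge0.
have b0 : 0 <= b by rewrite addr_ge0// sum2_ge0// => i j; exact: ltW.
have s0 : 0 <= \sum_i r i by apply: sumr_ge0 => i _; exact: ltW.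
pose C := 10 * (b / a) ^+ 3 * (b / a ^+ 2).
have C0 : 0 <= C.
  have ? : 0 <= b / a by rewrite divr_ge0// ltW.
  have ? : 0 <= b / a ^+ 2 by rewrite divr_ge0// exprn_ge0// ltW.
  by rewrite mulr_ge0// mulr_ge0// exprn_ge0.
pose g i j := C * K * (r i * c j / \sum_i r i) * b + x i * y j.
have g0 i j : 0 < g i j.
  rewrite ltr_wpDl ?mulr_gt0//; apply: mulr_ge0 => //; apply: mulr_ge0.
    exact: mulr_ge0.
  by rewrite divr_ge0// ltW// mulr_gt0.
exists (\sum_i \sum_j g i j), a; split=> //; first by rewrite sum2_ge0// => i j; exact: ltW.
move=> d B x' y' d0 da BA sB i j.
have Aab k l : a <= A k l <= b.
  by have := aA k l; have := Ab k l; have := A0 k l; move=> *; apply/andP; split; lra.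
have Bab k l : a <= B k l <= b.
  have := BA k l; rewrite ler_norml => /andP[p1 p2].
  by have := aA k l; have := Ab k l; move=> *; apply/andP; split; lra.
have e0 : 0 <= d * K by exact: mulr_ge0.
have rowe k : `|x k * \sum_l (B k l - A k l) * y l| <= d * K * r k.
  rewrite normrM (gtr0_norm (x0 k)) -mulrA.
  apply: le_trans (ler_wpM2l d0 (Kr k)); rewrite mulrCA ler_wpM2l ?(ltW (x0 k))//.
  rewrite mulr_sumr (le_trans (ler_norm_sum _ _ _))//; apply: ler_sum => l _.
  by rewrite normrM (gtr0_norm (y0 l)) ler_wpM2r// ltW.
have cole k : `|y k * \sum_l (B l k - A l k) * x l| <= d * K * c k.
  rewrite normrM (gtr0_norm (y0 k)) -mulrA.
  apply: le_trans (ler_wpM2l d0 (Kc k)); rewrite mulrCA ler_wpM2l ?(ltW (y0 k))//.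
  rewrite mulr_sumr (le_trans (ler_norm_sum _ _ _))//; apply: ler_sum => l _.
  by rewrite normrM (gtr0_norm (x0 l)) ler_wpM2r// ltW.
have stab := scaling_stability a0 i j Aab Bab sA sB e0 rowe cole.
apply: (@le_trans _ _ (d * g i j)); last by rewrite ler_wpM2l// le_sum2.
rewrite [X in `|X|](_ : _ = (x' i * y' j - x i * y j) * B i j +
  x i * y j * (B i j - A i j)); last by ring.
rewrite (le_trans (ler_normD _ _))// /g [leRHS]mulrDr lerD//.
  have /andP[p1 p2] := Bab i j.
  rewrite normrM [leRHS](_ : _ = C * (d * K) * (r i * c j / \sum_i r i) * b); last by ring.
  by rewrite ler_pM// ger0_norm// (le_trans (ltW a0)).
by rewrite normrM (gtr0_norm (mulr_gt0 (x0 i) (y0 j))) mulrC ler_wpM2r// ltW// mulr_gt0.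
Qed.

End Continuity.

Lemma scaled_toP (R : realType) m n (B : 'M[R]_(m, n)) (r : 'cV[R]_m)
    (c : 'cV[R]_n) (Q : 'M[R]_(m, n)) :
  scaled_to B r c Q ->
  exists (x : 'I_m -> R) (y : 'I_n -> R),
    scales_fun (fun i => r i 0) (fun j => c j 0) B x y /\
    Q = \matrix_(i, j) (x i * B i j * y j).
Proof.
move=> [x [y [x0 y0 [xr yc] ->]]].
exists (fun i => x i 0), (fun j => y j 0); split; first by split.
by apply/matrixP => i j; rewrite mul_mx_diag mul_diag_mx !mxE.
Qed.

Section Measurability.
Context d (T : measurableType d) (R : realType).

(** [S] is the preimage of an open set under finitely many functions, hence the union of those boxes
    with rational centres and radii 1 / (k + 1) that it contains, a countable family. *)
Lemma measurable_of_cylinder_open (I : finType) (f : I -> T -> R) (S : set T) :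
  (forall i, measurable_fun [set: T] (f i)) ->
  (forall w, S w -> exists2 e : R, 0 < e &
     forall w', (forall i, `|f i w' - f i w| < e) -> S w') ->
  measurable S.
Proof.
move=> mf Sopen.
pose box (p : {ffun I -> rat} * nat) : set T :=
  \bigcap_(i in [set: I]) [set w | `|f i w - ratr (p.1 i)| < p.2.+1%:R^-1].
have mbox p : measurable (box p).
  apply: fin_bigcap_measurable => // i _; rewrite -[X in measurable X]setTI.
  apply: (@measurable_fun_ltr _ _ _ _ _ (cst _)) => //.
  by apply: measurableT_comp => //; apply: measurable_funB.
have -> : S = \bigcup_(p in [set p | box p `<=` S]) box p.
  apply/seteqP; split => [w Sw|w [p /= pS /pS]//].
  have [e e0 he] := Sopen w Sw.
  (* A radius below e / 2 suffices: the box contains [w], and two of its points differ by less than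
     [e] in each coordinate. *)
  pose k := Num.truncn (2 / e).
  have ke : k.+1%:R^-1 < e / 2 :> R.
    rewrite -[ltRHS]invrK ltf_pV2 ?posrE ?invr_gt0 ?divr_gt0// invf_div.
    by have /andP[] := truncn_itv (ltW (divr_gt0 (@ltr0Sn R 1) e0)).
  have k0 : 0 < k.+1%:R^-1 :> R by rewrite invr_gt0.
  move: ke k0; set eta : R := k.+1%:R^-1 => ke k0.
  have rats i : exists q : rat, `|f i w - ratr q| < eta.
    have lt : f i w - eta < f i w + eta by lra.
    have [q] := rat_in_itvoo lt; rewrite in_itv /= => /andP[q1 q2]; exists q.
    by rewrite ltr_norml; apply/andP; split; lra.
  have [q qP] := choice rats.
  exists ([ffun i => q i], k); last by move=> i _ /=; rewrite ffunE.
  move=> w' bw'; apply: he => i; have := bw' i Logic.I; rewrite /= ffunE -/eta => h1.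
  have h2 := qP i.
  rewrite [X in `|X|](_ : _ = (f i w' - ratr (q i)) + - (f i w - ratr (q i))); last by ring.
  by rewrite (le_lt_trans (ler_normD _ _))// normrN; lra.
rewrite bigcup_mkcond; apply: countable_bigcupT_measurable => [|p].
  exact: countableP.
by case: ifP.
Qed.

(** Cauchy-Schwarz against the image of [v]. The l1 norms of the rows bound |E u| on the unit ball,
    so the supremum in [op_norm] is over a bounded set and dominates its elements. *)
Lemma bilinear_le_op_norm m n (E : 'M[R]_(m, n)) (w : 'I_m -> R) (v : 'I_n -> R) :
  \sum_i w i ^+ 2 <= 1 -> \sum_j v j ^+ 2 <= 1 ->
  \sum_i \sum_j w i * E i j * v j <= op_norm E.
Proof.
move=> w1 v1; pose vc : 'cV[R]_n := \col_j v j.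
have Ev i : \sum_j w i * E i j * v j = w i * (E *m vc) i 0.
  by rewrite mxE mulr_sumr; apply: eq_bigr => j _; rewrite mxE mulrA.
under eq_bigr => i _ do rewrite Ev.
apply: (@le_trans _ _ (l2norm (E *m vc))).
  set z := E *m vc; set N := l2norm z.
  have S0 : 0 <= \sum_i z i 0 ^+ 2 by apply: sumr_ge0 => i _; exact: sqr_ge0.
  have N2 : N ^+ 2 = \sum_i z i 0 ^+ 2 by rewrite sqr_sqrtr.
  have N0 : 0 <= N by exact: sqrtr_ge0.
  have [Ne|Ne] := eqVneq N 0.
    rewrite Ne big1// => i _; move: N2; rewrite Ne expr0n => /esym/eqP.
    rewrite psumr_eq0 => [/allP/(_ i (mem_index_enum _))|j _]; last exact: sqr_ge0.
    by rewrite sqrf_eq0 => /eqP ->; rewrite mulr0.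
  have Npos : 0 < N by rewrite lt_neqAle eq_sym Ne.
  rewrite -(ler_pM2l (mulr_gt0 (@ltr0Sn R 1) Npos)) mulr_sumr.
  apply: (@le_trans _ _ (\sum_i (N ^+ 2 * w i ^+ 2 + z i 0 ^+ 2))).
    by apply: ler_sum => i _; have := sqr_ge0 (N * w i - z i 0); rewrite sqrrB exprMn; lra.
  rewrite big_split/= -mulr_sumr -N2.
  by have := ler_wpM2l (sqr_ge0 N) w1; rewrite mulr1; lra.
apply: ub_le_sup; last first.
  exists vc => //=; rewrite /l2norm -sqrtr1 ler_sqrt//.
  by under eq_bigr => j _ do rewrite mxE.
exists (Num.sqrt (\sum_i (\sum_j `|E i j|) ^+ 2)) => _ [u /= u1 <-].
have u1' : \sum_j u j 0 ^+ 2 <= 1.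
  have S0 : 0 <= \sum_j u j 0 ^+ 2 by apply: sumr_ge0 => j _; exact: sqr_ge0.
  by move: u1; rewrite /l2norm -(@ler_sqr _ _ 1) ?nnegrE ?sqrtr_ge0// sqr_sqrtr// expr1n.
rewrite /l2norm ler_wsqrtr//; apply: ler_sum => i _.
rewrite -real_normK ?num_real// ler_sqr ?nnegrE ?sumr_ge0// mxE.
apply: (le_trans (ler_norm_sum _ _ _)); apply: ler_sum => j _.
by rewrite normrM ler_piMr// (sqr_sum_le1_norm_le1 u1').
Qed.

(** The complement is open in the entries: a norm above [t] is witnessed by one pair of test
    vectors, and by the local Lipschitz estimate the witness survives small changes of the
    entries. *)
Lemma measurable_op_norm_scaled m n (X : 'I_m -> 'I_n -> {mfun T >-> R})
    (r : 'cV[R]_m) (c : 'cV[R]_n) (Pt : T -> 'M[R]_(m, n)) (Q : 'M[R]_(m, n))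
    (t : R) :
  positive_mx r -> positive_mx c ->
  (forall w, positive_mx (\matrix_(i, j) X i j w)) ->
  (forall w, scaled_to (\matrix_(i, j) X i j w) r c (Pt w)) ->
  measurable [set w | op_norm (Pt w - Q) <= t].
Proof.
move=> r0 c0 X0 HP.
rewrite -[X in measurable X]setCK; apply: measurableC.
apply: (@measurable_of_cylinder_open (Finite.clone ('I_m * 'I_n)%type _) (fun ij => X ij.1 ij.2)).
  by move=> ij; exact: measurable_funPT.
move=> w /= /negP; rewrite -ltNge => tX.
(* For negative [t] the complement is the whole space; zero test vectors show that the norm is
   nonnegative. *)
have [t0|t0] := ltP t 0.
  exists 1 => // w' _; apply/negP; rewrite -ltNge (lt_le_trans t0)//.
  have z1 k : \sum_(i < k) (0 : R) ^+ 2 <= 1 by rewrite big1// => i _; rewrite expr0n.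
  apply: le_trans (bilinear_le_op_norm (Pt w' - Q) (z1 m) (z1 n)).
  by rewrite sumr_ge0// => i _; rewrite sumr_ge0// => j _; rewrite mulr0.
have [u [v [u1 v1 tuv]]] : exists u v, [/\ \sum_i u i ^+ 2 <= 1,
    \sum_j v j ^+ 2 <= 1 & t < \sum_i \sum_j u i * (Pt w - Q) i j * v j].
  apply: contrapT => h; move: tX; rewrite ltNge => /negP; apply.
  apply: op_norm_le => // u v u1 v1; rewrite leNgt; apply/negP => h1.
  by apply: h; exists u, v.
set V := \sum_i _ in tuv.
have [x [y [sxy PE]]] := scaled_toP (HP w).
have [G [d0 [G0 d00 HG]]] := scaling_locally_lipschitz (X0 w) (fun i => r0 i 0)
  (fun j => c0 j 0) sxy.
pose S := (\sum_i `|u i|) * (\sum_j `|v j|).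
have S0 : 0 <= S by rewrite mulr_ge0// sumr_ge0.
have GS : 0 < 1 + G * S by rewrite ltr_pwDl// mulr_ge0.
(* The test value drops by at most e G S; the extra 1 in the denominator makes this strictly less
   than V - t. *)
pose e := Num.min d0 ((V - t) / (1 + G * S)).
have e0 : 0 < e by rewrite lt_min d00 divr_gt0// subr_gt0.
exists e => // w' hw'; apply/negP; rewrite -ltNge.
have [x' [y' [sxy' PE']]] := scaled_toP (HP w').
have diff i j : `|Pt w' i j - Pt w i j| <= e * G.
  have := HG e _ x' y' (ltW e0) _ _ sxy' i j.
  have -> : Pt w i j = x i * (\matrix_(i, j) X i j w) i j * y j by rewrite PE !mxE.
  have -> : Pt w' i j = x' i * (\matrix_(i, j) X i j w') i j * y' j by rewrite PE' !mxE.
  apply; first by rewrite ge_min lexx.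
  by move=> k l; rewrite !mxE; exact: ltW (hw' (k, l)).
apply: lt_le_trans (bilinear_le_op_norm _ u1 v1).
have -> : \sum_i \sum_j u i * (Pt w' - Q) i j * v j =
    V + \sum_i \sum_j u i * (Pt w' i j - Pt w i j) * v j.
  rewrite -big_split/=; apply: eq_bigr => i _; rewrite -big_split/=.
  by apply: eq_bigr => j _; rewrite !mxE; ring.
have low : - (e * G * S) <= \sum_i \sum_j u i * (Pt w' i j - Pt w i j) * v j.
  rewrite lerNl -sumrN /S mulr_suml mulr_sumr; apply: ler_sum => i _.
  rewrite -sumrN mulr_sumr mulr_sumr; apply: ler_sum => j _.
  apply: (le_trans (ler_norm _)); rewrite normrN !normrM.
  by rewrite mulrAC [leRHS]mulrC ler_wpM2l// mulr_ge0.
have : e * (1 + G * S) <= V - t by rewrite -ler_pdivlMr// ge_min lexx orbT.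
rewrite mulrDr mulr1 mulrA => h; have := e0; lra.
Qed.

End Measurability.

(** * The high-probability bound *)

Lemma expectation_bounds d (T : measurableType d) (R : realType)
    (P : probability T R) (X : {RV P >-> R}) (a b mu : R) :
  0 < a -> 0 < b -> (forall w, 0 <= X w) -> {ae P, forall w, a <= X w <= b} ->
  (mu%:E = 'E_P[X])%E -> a <= mu <= b.
Proof.
move=> a0 b0 X0 Xab Emu; rewrite -!lee_fin Emu -!(expectation_cst P).
have mX : measurable_fun [set: T] X by exact: measurable_funPT.
apply/andP; split; apply: expectation_le => //=.
- by move=> _; exact: ltW.
- by apply: filterS Xab => w /andP[].
- by move=> _; exact: ltW.
- by apply: filterS Xab => w /andP[].
Qed.

(** Outside the exceptional event of the concentration step, of probability at most 6 / q, and a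
    null set where some entry leaves [a, b], the deterministic difference bound applies. *)
Lemma scaled_concentration d (T : measurableType d) (R : realType)
    (P : probability T R) (m n : nat) (r : 'cV[R]_m) (c : 'cV[R]_n)
    (X : 'I_m -> 'I_n -> {RV P >-> R}) (a b tau : R)
    (A Q : 'M[R]_(m, n)) (Pt : T -> 'M[R]_(m, n)) :
  (0 < m)%N -> (0 < n)%N -> (2 <= maxn m n)%N -> 0 < a -> 0 < b ->
  positive_mx r -> positive_mx c -> l1norm r = l1norm c ->
  (forall w, positive_mx (\matrix_(i, j) X i j w)) ->
  mutually_independent (fun ij : 'I_m * 'I_n => X ij.1 ij.2) ->
  (forall i j, {ae P, forall w, a <= X i j w <= b}) ->
  (forall i j, (A i j)%:E = ('E_P[X i j])%E) ->
  (forall w, scaled_to (\matrix_(i, j) X i j w) r c (Pt w)) ->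
  scaled_to A r c Q ->
  tau = b * Num.sqrt (84 * ln (maxn m n)%:R) ->
  ((1 - 6 / (maxn m n)%:R)%:E <= P [set w | (op_norm (Pt w - Q) <=
    (10 * (b / a) ^+ 3 * (b / a ^+ 2) * (tau * (b / a ^+ 2)) * b
        + b / a ^+ 2 * (tau + 2 * b)) * (rho1 r c * rho3 r c))%R])%E.
Proof.
move=> m0 n0 q2 a0 b0 r0 c0 rc X0 indep Xab EA HPt HQ tauE; set q : R := (maxn m n)%:R.
set S := [set w | _].
have mS : measurable S by exact: measurable_op_norm_scaled.
have ab : a <= b.
  by have [w /andP[p1 p2]] := ae_exists (Xab (Ordinal m0) (Ordinal n0)); exact: le_trans p2.
have Aab i j : a <= A i j <= b.
  apply: expectation_bounds (EA i j) => // w.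
  by have := X0 w i j; rewrite mxE => /ltW.
have [x [y [sA QE]]] := scaled_toP HQ.
have card_m : (#|'I_m| <= maxn m n)%N by rewrite card_ord leq_maxl.
have card_n : (#|'I_n| <= maxn m n)%N by rewrite card_ord leq_maxr.
have [bad [mbad Pbad Hgood]] := matrix_concentration x y a0 ab indep
  (fun ij => Xab ij.1 ij.2) (fun ij => EA ij.1 ij.2) q2 card_m card_n.
have [Z [mZ PZ0 subZ]] : {ae P, forall w, forall ij : 'I_m * 'I_n, a <= X ij.1 ij.2 w <= b}.
  by apply: filter_forall => ij; exact: Xab.
have subS : ~` S `<=` bad `|` Z.
  move=> w; apply: contra_notP => /not_orP[nbad nZ].
  have Xw i j : a <= (\matrix_(i, j) X i j w) i j <= b.
    rewrite mxE; move: i j; have := contra_not (@subZ w) nZ; move=> /contrapT h i j.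
    exact: (h (i, j)).
  have [x' [y' [sB PE]]] := scaled_toP (HPt w).
  have [h1 h2 h3] := Hgood w nbad.
  rewrite -tauE in h1 h2 h3; rewrite /S /= PE QE; apply: scaled_difference_bound => //.
  - by rewrite tauE mulr_ge0 ?sqrtr_ge0// ltW.
  - move=> i; under eq_bigr => j _ do rewrite mxE; exact: h1.
  - move=> j; under eq_bigr => i _ do rewrite mxE; exact: h2.
  - move=> g h g1 h1'; have := h3 g h g1 h1'.
    by under [X in _ -> X <= _]eq_bigr => i _ do under eq_bigr => j _ do rewrite mxE.
have PCS : (P (~` S) <= (6 / q)%:E)%E.
  apply: (le_trans (le_measure P _ _ subS)).
  - by rewrite inE; exact: measurableC.
  - by rewrite inE; exact: measurableU.
  by apply: (le_trans (measureU2 _ mbad mZ)); rewrite [X in (_ + X)%E]PZ0 adde0.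
rewrite probability_setC// in PCS.
move: PCS; rewrite -(fineK (fin_num_measure P _ mS)).
have -> : (1 - (fine (P S))%:E = (1 - fine (P S))%:E)%E by [].
by rewrite !lee_fin; lra.
Qed.

Lemma rho1_ge0 (R : realType) m n (r : 'cV[R]_m) (c : 'cV[R]_n) : 0 <= rho1 r c.
Proof.
by rewrite le_max divr_ge0 ?sqrtr_ge0// /l1norm sumr_ge0.
Qed.

Lemma rho3_ge0 (R : realType) m n (r : 'cV[R]_m) (c : 'cV[R]_n) :
  (0 < m)%N -> (0 < n)%N -> positive_mx r -> positive_mx c -> 0 <= rho3 r c.
Proof.
move=> m0 n0 r0 c0.
have rM0 := lt_le_trans (r0 (Ordinal m0) 0) (entry_le_max _ _).
have cM0 := lt_le_trans (c0 (Ordinal n0) 0) (entry_le_max _ _).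
rewrite divr_ge0 ?(ltW (l1norm_gt0 m0 r0))// mulr_ge0//.
  by rewrite mulr_ge0 ?sqrtr_ge0// ltW.
by rewrite mulr_ge0 ?sqrtr_ge0// ltW.
Qed.

(** It gives sqrt (ln q) >= 1/2, so that constant terms can be absorbed into the logarithmic rate.
    The bound on ln 2 comes from ln (1 - 1/2) <= - 1/2. *)
Lemma quarter_le_ln (R : realType) (q : nat) : (2 <= q)%N ->
  4^-1 <= ln (q%:R : R).
Proof.
move=> q2; apply: (@le_trans _ _ (ln (2 : R))); last first.
  by rewrite ler_ln ?posrE ?ltr0n ?ler_nat// (leq_trans _ q2).
have h : -1 < - 2^-1 :> R by lra.
have := le_ln1Dx h; have -> : 1 + - 2^-1 = 2^-1 :> R by field.
by rewrite lnV ?posrE//; lra.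
Qed.

Theorem theorem6 (R : realType)
    (N0 : nat) (hN0 : (0 < N0)%N)
    (M : nat -> nat)
    (hM : forall N, (N0 <= N)%N -> (0 < M N)%N)
    (hMlim : M N @[N --> \oo] --> \oo)
    (r : forall N, 'cV[R]_(M N)) (c : forall N, 'cV[R]_N)
    (hr : forall N, (N0 <= N)%N -> positive_mx (r N))
    (hc : forall N, (N0 <= N)%N -> positive_mx (c N))
    (hs : forall N, (N0 <= N)%N -> l1norm (r N) = l1norm (c N))
    (d : nat -> measure_display) (T : forall N, measurableType (d N))
    (P : forall N, probability (T N) R)
    (At : forall N, 'I_(M N) -> 'I_N -> {RV (P N) >-> R})
    (At_pos : forall N, (N0 <= N)%N ->
      forall w, positive_mx (\matrix_(i, j) At N i j w))
    (At_indep : forall N, (N0 <= N)%N ->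
      mutually_independent (fun ij : 'I_(M N) * 'I_N => At N ij.1 ij.2))
    (a b : R) (ha : 0 < a) (hb : 0 < b)
    (At_bnd : forall N, (N0 <= N)%N -> forall i j,
      {ae P N, forall w, a <= At N i j w <= b})
    (A : forall N, 'M[R]_(M N, N))
    (hA : forall N, (N0 <= N)%N ->
      forall i j, (A N i j)%:E = ('E_(P N)[At N i j])%E)
    (Pt : forall N, T N -> 'M[R]_(M N, N))
    (hPt : forall N, (N0 <= N)%N -> forall w,
      scaled_to (\matrix_(i, j) At N i j w) (r N) (c N) (Pt N w))
    (Pm : forall N, 'M[R]_(M N, N))
    (hPm : forall N, (N0 <= N)%N -> scaled_to (A N) (r N) (c N) (Pm N)) :
  bigO_whp P (fun N w => op_norm (Pt N w - Pm N))
    (fun N => rho1 (r N) (c N) * rho2 (r N) (c N) * rho3 (r N) (c N)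
              * Num.sqrt (ln (maxn (M N) N)%:R)).
Proof.
(* With tau = t84 sqrt (ln q) and 2 b <= 4 b sqrt (ln q), the constant of the difference bound is at
   most C sqrt (ln q). *)
pose K1 := 10 * (b / a) ^+ 3 * (b / a ^+ 2) * (b / a ^+ 2) * b.
pose t84 : R := b * Num.sqrt 84.
pose C := K1 * t84 + b / a ^+ 2 * (t84 + 4 * b).
have ba0 : 0 <= b / a ^+ 2 by rewrite divr_ge0 ?exprn_ge0// ltW.
exists C.
(* The failure probability 6 / q is at most 12 / (N + 1) because N + 1 <= 2 q, so the lower bound
   comes from the harmonic sequence. Starting at N >= 2 ensures q >= 2. *)
apply: (@squeeze_cvge _ _ _ _ (fun N => (1 - 12 * N.+1%:R^-1)%:E) _ (fun=> 1%E)).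
- exists (maxn N0 2) => // N /=; rewrite geq_max => /andP[N0N N2].
  have m0 := hM N N0N; have n0 : (0 < N)%N by exact: leq_trans N2.
  set q := maxn (M N) N; have q2 : (2 <= q)%N by rewrite leq_max N2 orbT.
  have q0 : (0 < q)%N by exact: leq_trans q2.
  rewrite probability_le1 ?andbT; last first.
    apply: measurable_op_norm_scaled (hr _ N0N) (hc _ N0N) (At_pos _ N0N) (hPt _ N0N).
  have conc := scaled_concentration m0 n0 q2 ha hb (hr _ N0N) (hc _ N0N) (hs _ N0N)
    (At_pos _ N0N) (At_indep _ N0N) (At_bnd _ N0N) (hA _ N0N) (hPt _ N0N) (hPm _ N0N)
    erefl.
  apply: (@le_trans _ _ (1 - 6 / q%:R)%:E).
    rewrite lee_fin lerD2l lerN2 ler_pdivrMr ?ltr0n// mulrAC ler_pdivlMr ?ltr0n//.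
    have : N.+1%:R <= 2 * q%:R :> R.
      rewrite -natrM ler_nat; have := leq_maxr (M N) N; rewrite -/q; lia.
    by move: (N.+1%:R : R) (q%:R : R) => u v; lra.
  apply: (le_trans conc); apply: le_measure; rewrite ?inE.
  + exact: measurable_op_norm_scaled (hr _ N0N) (hc _ N0N) (At_pos _ N0N) (hPt _ N0N).
  + exact: measurable_op_norm_scaled (hr _ N0N) (hc _ N0N) (At_pos _ N0N) (hPt _ N0N).
  move=> w /= /le_trans; apply.
  have L1 := quarter_le_ln R q2.
  set l := Num.sqrt (ln q%:R).
  have l1 : 2^-1 <= l.
    have -> : 2^-1 = Num.sqrt (4^-1) :> R.
      by rewrite -[RHS]/(Num.sqrt _) (_ : 4^-1 = 2^-1 ^+ 2); [rewrite sqrtr_sqr ger0_norm | field].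
    by rewrite ler_wsqrtr.
  have l0 : 0 <= l by exact: sqrtr_ge0.
  have -> : b * Num.sqrt (84 * ln q%:R) = t84 * l by rewrite sqrtrM// mulrA.
  have r1 := rho1_ge0 (r N) (c N); have r3 := rho3_ge0 m0 n0 (hr _ N0N) (hc _ N0N).
  have r2 := rho2_ge1 (c N) m0 (hr _ N0N).
  have C0 : 0 <= C.
    have ? : 0 <= t84 by rewrite mulr_ge0 ?sqrtr_ge0// ltW.
    have ? : 0 <= b / a by rewrite divr_ge0// ltW.
    rewrite addr_ge0// mulr_ge0//; last by rewrite addr_ge0// mulr_ge0// ltW.
    rewrite mulr_ge0//; last exact: ltW.
    by rewrite mulr_ge0// mulr_ge0// mulr_ge0// exprn_ge0.
  apply: (@le_trans _ _ (C * l * (rho1 (r N) (c N) * rho3 (r N) (c N)))).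
    rewrite ler_wpM2r ?(mulr_ge0 r1 r3)//.
    have bl : 2 * b <= 4 * b * l.
      rewrite [leRHS](_ : _ = 2 * b * (2 * l)); last by ring.
      by rewrite ler_peMr ?mulr_ge0 ?(ltW hb)//; lra.
    have := ler_wpM2l ba0 bl; rewrite /C /K1; lra.
  (* Multiplication by [rho2], which is at least 1, yields the stated rate. *)
  rewrite [leRHS](_ : _ = rho2 (r N) (c N) *
    (C * l * (rho1 (r N) (c N) * rho3 (r N) (c N)))); last by ring.
  by rewrite ler_peMl// mulr_ge0 ?(mulr_ge0 r1 r3)// mulr_ge0.
- apply: cvg_EFin; first exact: nearW.
  rewrite -[X in _ --> X](subr0 1) -[X in _ - X](mulr0 12).
  apply: cvgB; first exact: cvg_cst.
  by apply: cvgMr; exact: cvg_harmonic.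
- exact: cvg_cst.
Qed.
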